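(* Suppose that the kernel sets $\mathcal K_n$ satisfy conditions (1)--(4) listed in the context, that $s\in\mathbb L^2(\mathbb R^d)$, and that there exists $\alpha>0$ such that $\mathbb E(\exp(\alpha|\ell(Y_1)|))<\infty$. Then there exist deterministic constants $\mathfrak c,\overline{\mathfrak c}>0$, not depending on $n$, such that for every $n\geqslant 2$ and every $\theta\in\,]0,1[$, $$\mathbb E\left(\sup_{K\in\mathcal K_n}\left\{\|\widehat s_{K,\ell}(n;\cdot)-s\|_2^2-(1+\theta)\left(\|s_{K,\ell}-s\|_2^2+\frac{\overline s_{K,\ell}}{n}\right)\right\}\right)\leqslant\mathfrak c\,\frac{\log(n)^5}{\theta n}$$ and $$\mathbb E\left(\sup_{K\in\mathcal K_n}\left\{\|s_{K,\ell}-s\|_2^2+\frac{\overline s_{K,\ell}}{n}-\frac{1}{1-\theta}\|\widehat s_{K,\ell}(n;\cdot)-s\|_2^2\right\}\right)\leqslant\overline{\mathfrak c}\,\frac{\log(n)^5}{\theta(1-\theta)n}.$$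
   Context: Setting. Let $d\in\mathbb N^*$, and let $(X_1,Y_1),\dots,(X_n,Y_n)$ be independent $\mathbb R^d\times\mathbb R$-valued random variables with the same distribution (not depending on $n$), assumed absolutely continuous with respect to Lebesgue measure; $f$ is a density of $X_1$. Let $\ell:\mathbb R\to\mathbb R$ be a Borel function and $s(x):=\mathbb E(\ell(Y_1)\mid X_1=x)f(x)$, $x\in\mathbb R^d$. Here $\|\cdot\|_2$ and $\langle\cdot,\cdot\rangle_2$ are the norm and inner product of $\mathbb L^2(\mathbb R^d)$ for Lebesgue measure. For each $n$, $\mathcal K_n$ is a (nonempty) set of symmetric continuous maps $K:\mathbb R^d\times\mathbb R^d\to\mathbb R$ (called kernels), of cardinality at most $n$. For $K\in\mathcal K_n$, $$\widehat s_{K,\ell}(n;x):=\frac1n\sum_{i=1}^nK(X_i,x)\ell(Y_i),\qquad s_{K,\ell}:=\mathbb E(\widehat s_{K,\ell}(n;\cdot))=\mathbb E(K(X_1,\cdot)\ell(Y_1)),\qquad \overline s_{K,\ell}:=\mathbb E(\|K(X_1,\cdot)\ell(Y_1)\|_2^2).$$ Conditions: there exists a deterministic constant $\mathfrak m>0$, not depending on $n$, such that (1) for every $K\in\mathcal K_n$, $\sup_{x'\in\mathbb R^d}\|K(x',\cdot)\|_2^2\leqslant\mathfrak m\,n$; (2) for every $K\in\mathcal K_n$, $\|s_{K,\ell}\|_2^2\leqslant\mathfrak m$; (3) for every $K,K'\in\mathcal K_n$, $\mathbb E(\langle K(X_1,\cdot),K'(X_2,\cdot)\ell(Y_2)\rangle_2^2)\leqslant\mathfrak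 m\,\overline s_{K',\ell}$ (with $(X_2,Y_2)$ an independent copy of $(X_1,Y_1)$); (4) for every $K\in\mathcal K_n$ and $\psi\in\mathbb L^2(\mathbb R^d)$, $\mathbb E(\langle K(X_1,\cdot),\psi\rangle_2^2)\leqslant\mathfrak m\|\psi\|_2^2$. *)

(* Defs.v *)
From HB Require Import structures.
From mathcomp Require Import all_boot all_order all_algebra.
From mathcomp Require Import all_classical all_reals all_analysis.
From mathcomp Require Import measurable_realfun.
Import Order.TTheory GRing.Theory Num.Theory.
Import numFieldNormedType.Exports.

Set Implicit Arguments.
Unset Strict Implicit.
Unset Printing Implicit Defensive.

Local Open Scope classical_set_scope.
Local Open Scope ring_scope.

(* The sigma-algebra of R^d is generated by the coordinate maps, as for the
   library's tuples; [measurable_rV_borel] shows that it is the Borel one. *)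
Section measurable_rV.
Context {R : realType} (d : nat).

Let coors : 'I_d -> 'rV[R]_d -> R := fun i v => v ord0 i.

Let rV_set0 : g_sigma_preimage coors set0.
Proof. exact: sigma_algebra0. Qed.

Let rV_setC A : g_sigma_preimage coors A -> g_sigma_preimage coors (~` A).
Proof. exact: sigma_algebraC. Qed.

Let rV_bigcup (F : _^nat) : (forall i, g_sigma_preimage coors (F i)) ->
  g_sigma_preimage coors (\bigcup_i (F i)).
Proof. exact: sigma_algebra_bigcup. Qed.

HB.instance Definition _ := @isMeasurable.Build default_measure_display
  'rV[R]_d (g_sigma_preimage coors) rV_set0 rV_setC rV_bigcup.

End measurable_rV.

Section measurable_rV_lemmas.
Context {R : realType}.

Lemma measurable_coord d (i : 'I_d) :
  measurable_fun [set: 'rV[R]_d] (fun v : 'rV[R]_d => v ord0 i).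
Proof.
move=> _ Y mY; rewrite setTI; apply: sub_sigma_algebra => /=.
rewrite -bigcup_seq/=; exists i => /=; first by rewrite mem_index_enum.
by exists Y => //; rewrite setTI.
Qed.

Lemma measurable_fun_rVP d d1 (T1 : measurableType d1) (f : T1 -> 'rV[R]_d) :
  measurable_fun [set: T1] f <->
  forall i, measurable_fun [set: T1] (fun t => f t ord0 i).
Proof.
split=> [mf i|mf].
  exact: (measurableT_comp (@measurable_coord d i) mf).
apply: (@measurability _ _ _ _ _ _
  (\big[setU/set0]_(i < d) preimage_set_system setT
     (fun v : 'rV[R]_d => v ord0 i) measurable)) => //.
move=> _ [B + <-].
rewrite -bigcup_seq => -[i _ [Y mY <-]].
by have := mf i measurableT Y mY; rewrite !setTI.
Qed.

Definition cons_rV d (p : measurableTypeR R * 'rV[R]_d) : 'rV[R]_d.+1 := row_mx p.1%:M p.2.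

Definition uncons_rV d (v : 'rV[R]_(1 + d)) : measurableTypeR R * 'rV[R]_d :=
  (v ord0 ord0, rsubmx v).

Lemma cons_rVK d : cancel (@cons_rV d) (@uncons_rV d).
Proof.
move=> [x v]; rewrite /uncons_rV /cons_rV/= row_mxKr; congr pair.
by rewrite (_ : ord0 = lshift d ord0 :> 'I_(1 + d)) ?row_mxEl ?mxE//; exact/val_inj.
Qed.

Lemma uncons_rVK d : cancel (@uncons_rV d) (@cons_rV d).
Proof.
move=> v; rewrite /uncons_rV /cons_rV/= -[RHS]hsubmxK; congr row_mx.
apply/rowP => i; rewrite !ord1 !mxE eqxx mulr1n.
by congr (v _ _); exact/val_inj.
Qed.

Lemma measurable_cons_rV d : measurable_fun [set: measurableTypeR R * 'rV[R]_d] (@cons_rV d).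
Proof.
apply/measurable_fun_rVP => i.
case: (split_ordP (i : 'I_(1 + d))) => j ->.
  rewrite (_ : (fun _ => _) = fst)//; apply/funext => p.
  by apply: etrans (row_mxEl p.1%:M p.2 ord0 j) _; rewrite mxE !ord1 eqxx.
rewrite (_ : (fun _ => _) = (fun v : 'rV[R]_d => v ord0 j) \o snd).
  exact: (measurableT_comp (@measurable_coord d j)).
by apply/funext => p; exact: row_mxEr.
Qed.

Lemma measurable_uncons_rV d :
  measurable_fun [set: 'rV[R]_d.+1] (@uncons_rV d).
Proof.
apply: measurable_fun_pair => /=.
  exact: (@measurable_coord d.+1 ord0).
apply/measurable_fun_rVP => i.
under eq_fun do rewrite /= mxE.
exact: measurable_coord.
Qed.

Lemma open_rV_measurable d (U : set 'rV[R]_d) : open U -> measurable U.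
Proof.
move=> oU.
pose C (p : 'rV[rat]_d * nat) : set 'rV[R]_d :=
  [set v | forall i, ball (ratr (p.1 ord0 i) : R) p.2.+1%:R^-1 (v ord0 i)].
have mC p : measurable (C p).
  rewrite (_ : C p = \bigcap_(i in [set: 'I_d])
      ((fun v : 'rV[R]_d => v ord0 i) @^-1`
        ball (ratr (p.1 ord0 i) : R) p.2.+1%:R^-1)).
    apply: fin_bigcap_measurable => // i _.
    rewrite -[X in measurable X]setTI; apply: measurable_coord => //.
    by apply: open_measurable; apply: ball_open.
  by apply/seteqP; split => v /= Cv i; [move=> _|]; exact: Cv.
have -> : U = \bigcup_p (if `[< C p `<=` U >] then C p else set0).
  apply/seteqP; split => [v Uv|v [p _]]; last by case: asboolP => // /[apply].
  have /nbhs_ballP[e /= e0 eU] : nbhs v U by exact: open_nbhs_nbhs.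
  have [k _ kP] := near_infty_natSinv_lt (PosNum (divr_gt0 e0 (ltr0n _ 2))).
  have /= {}kP := kP k (leqnn k).
  have k0 : 0 < k.+1%:R^-1 :> R by rewrite invr_gt0.
  have /choice[q qP] (i : 'I_d) :
      exists q : rat, `|ratr q - v ord0 i| < k.+1%:R^-1.
    have /rat_in_itvoo[q /itvP qv] :
      v ord0 i - k.+1%:R^-1 < v ord0 i + k.+1%:R^-1.
      by rewrite ltrD2l; apply: lt_trans k0; rewrite oppr_lt0.
    by exists q; rewrite ltr_distl !qv.
  exists (\row_i q i, k) => //; case: asboolP => [_ i|].
    by rewrite /= mxE; exact: qP.
  case=> w Cw; apply: eU; split => // a i; rewrite ord1 /ball/=.
  have := Cw i; rewrite /= mxE /ball/= => qw.
  rewrite (splitr e) -(subrKA (ratr (q i))).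
  rewrite (le_lt_trans (ler_normD _ _))// ltrD//; last exact: lt_trans qw kP.
  by rewrite distrC; exact: lt_trans (qP i) kP.
apply: countable_bigcupT_measurable => // p.
by case: asboolP => // _; exact: mC.
Qed.

Lemma measurable_rV_borel d :
  @measurable _ 'rV[R]_d = <<s [set U : set 'rV[R]_d | open U] >>.
Proof.
apply/seteqP; split; last first.
  apply: smallest_sub => [|U /= oU]; first exact: sigma_algebra_measurable.
  exact: open_rV_measurable.
apply: smallest_sub; first exact: smallest_sigma_algebra.
move=> B; rewrite -bigcup_seq => -[i _ [Y mY <-]] {B}.
pose bT := g_sigma_algebraType [set U : set 'rV[R]_d | open U].
have mcoord : measurable_fun [set: bT] (fun v : bT => (v : 'rV[R]_d) ord0 i).
  apply: (@measurability _ _ bT (measurableTypeR R) _ _ (@RGenOpens.G R)).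
    exact: RGenOpens.measurableE.
  move=> _ [_ [x [y ->]] <-]; rewrite setTI; apply: sub_sigma_algebra => /=.
  apply: open_comp => [v _|]; last exact: interval_open.
  exact: (@coord_continuous R 1 d ord0 i v).
exact: (mcoord measurableT Y mY).
Qed.

End measurable_rV_lemmas.

Section pushforward_cons.
Context {R : realType} (d : nat).
Variable m : {sigma_finite_measure set 'rV[R]_d -> \bar R}.

Definition lebesgue_cons : set 'rV[R]_d.+1 -> \bar R :=
  pushforward (lebesgue_measure \x m)%E (@cons_rV R d).

Let lebesgue_cons0 : lebesgue_cons set0 = 0%E.
Proof. by rewrite /lebesgue_cons /pushforward preimage_set0 measure0. Qed.

Let lebesgue_cons_ge0 A : (0 <= lebesgue_cons A)%E.
Proof. by rewrite /lebesgue_cons /pushforward measure_ge0. Qed.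

Let lebesgue_cons_semi_sigma_additive : semi_sigma_additive lebesgue_cons.
Proof.
rewrite /lebesgue_cons; apply: measure_semi_sigma_additive.
exact: measurable_cons_rV.
Qed.

HB.instance Definition _ := isMeasure.Build _ _ _ lebesgue_cons
  lebesgue_cons0 lebesgue_cons_ge0 lebesgue_cons_semi_sigma_additive.

Let sigma_finite_lebesgue_cons : sigma_finite setT lebesgue_cons.
Proof.
have /sigma_finiteP[F [TF ndF Foo]] := sigma_finiteT (@lebesgue_measure R).
have /sigma_finiteP[G [TG ndG Goo]] := sigma_finiteT m.
exists (fun n => @uncons_rV R d @^-1` (F n `*` G n)).
  rewrite -preimage_bigcup (_ : \bigcup_n _ = setT) ?preimage_setT//.
  rewrite -subTset => -[x v] _.
  have [i _ Fix] : (\bigcup_i F i) x by rewrite -TF.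
  have [j _ Gjv] : (\bigcup_i G i) v by rewrite -TG.
  exists (maxn i j) => //; split => /=.
  - by move: x Fix; exact/subsetPset/ndF/leq_maxl.
  - by move: v Gjv; exact/subsetPset/ndG/leq_maxr.
move=> n; have [mFn Fnoo] := Foo n; have [mGn Gnoo] := Goo n; split.
  rewrite -[X in measurable X]setTI; apply: measurable_uncons_rV => //.
  exact: measurableX.
rewrite /lebesgue_cons /pushforward -comp_preimage.
rewrite (_ : _ \o _ = id); last by apply/funext => x; exact: cons_rVK.
rewrite preimage_id product_measure1E// lte_mul_pinfty// ge0_fin_numE//.
Qed.

HB.instance Definition _ := Measure_isSigmaFinite.Build _ _ _ lebesgue_cons
  sigma_finite_lebesgue_cons.

End pushforward_cons.

Fixpoint lebesgue_rV (R : realType) (d : nat) :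
    {sigma_finite_measure set 'rV[R]_d -> \bar R} :=
  match d with
  | 0 => \d_(0 : 'rV[R]_0)
  | d'.+1 => lebesgue_cons (lebesgue_rV R d')
  end.

Lemma lebesgue_rV_box (R : realType) (d : nat) (A : 'I_d -> set R) :
  (forall i, measurable (A i)) ->
  lebesgue_rV R d [set v | forall i, A i (v ord0 i)] =
  (\prod_(i < d) lebesgue_measure (A i))%E.
Proof.
elim: d A => [|d IHd] A mA.
  rewrite big_ord0 [LHS](_ : _ = \d_(0 : 'rV[R]_0)
    [set v : 'rV[R]_0 | forall i, A i (v ord0 i)])//.
  by rewrite diracE mem_set// => -[].
rewrite big_ord_recl -(IHd _ (fun i => mA (lift ord0 i))).
have mB : measurable [set v : 'rV[R]_d | forall i, A (lift ord0 i) (v ord0 i)].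
  rewrite (_ : mkset _ = \bigcap_(i in [set: 'I_d])
      ((fun v : 'rV[R]_d => v ord0 i) @^-1` A (lift ord0 i))).
    apply: fin_bigcap_measurable => // i _.
    by rewrite -[X in measurable X]setTI; exact: measurable_coord.
  by apply/seteqP; split => v /= Av i; [move=> _|]; exact: Av.
rewrite -(product_measure1E lebesgue_measure (lebesgue_rV R d) (mA ord0) mB).
rewrite /= /lebesgue_cons /pushforward.
congr (product_measure1 _ _ _).
have coord0 (p : measurableTypeR R * 'rV[R]_d) : cons_rV p ord0 ord0 = p.1.
  by have /(congr1 fst) := cons_rVK p.
have coordS (p : measurableTypeR R * 'rV[R]_d) i :
    cons_rV p ord0 (lift ord0 i) = p.2 ord0 i.
  have pE : p.2 = rsubmx (cons_rV p : 'rV[R]_(1 + d)).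
    by have /(congr1 snd) := cons_rVK p.
  by rewrite [in RHS]pE [in RHS]mxE; congr (cons_rV p _ _); exact/val_inj.
apply/seteqP; split => [p /= Ap|p /= [Ap0 ApS] i].
  split; first by have := Ap ord0; rewrite coord0.
  by move=> i; have := Ap (lift ord0 i); rewrite coordS.
by case: (unliftP ord0 i) => [j|] ->; rewrite ?coordS ?coord0.
Qed.

Section L2_rV.
Context {R : realType} {d : nat}.
Implicit Types g h : 'rV[R]_d -> R.

Definition L2norm_sq g : \bar R :=
  ('N[lebesgue_rV R d]_2%:E[EFin \o g] ^+ 2)%E.

Definition L2dot g h : R := \int[lebesgue_rV R d]_x (g x * h x).

Definition L2fun : {pred 'rV[R]_d -> R} := Lfun (lebesgue_rV R d) 2%:E.

End L2_rV.
Arguments L2norm_sq {R d} g%_R.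
Arguments L2dot {R d} (g h)%_R.

Definition mutually_independent (R : realType) (dO dT : measure_display)
    (Omega : measurableType dO) (T : measurableType dT)
    (P : probability Omega R) (n : nat) (Z : 'I_n -> {mfun Omega >-> T}) :=
  forall (J : {set 'I_n}) (A : 'I_n -> set T), (forall i, measurable (A i)) ->
    P [set w | forall i, i \in J -> A i (Z i w)] =
    (\prod_(i in J) P (Z i @^-1` A i))%E.

(* Measures are specified on measurable sets only, hence the restriction to
   such sets in the equality of laws. *)
Definition iid_sample (R : realType) (dO dT : measure_display)
    (Omega : measurableType dO) (T : measurableType dT)
    (P : probability Omega R) (law : probability T R)
    (n : nat) (Z : 'I_n -> {mfun Omega >-> T}) :=
  mutually_independent P Z /\
  forall i A, measurable A -> distribution P (Z i) A = law A.

Definition density_kernel (R : realType) (d : nat) (K : 'rV[R]_d -> 'rV[R]_d -> R) :=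
  (forall x y, K x y = K y x) /\
  continuous (fun p : 'rV[R]_d * 'rV[R]_d => K p.1 p.2).

(* [law] is the common law of the pairs (X_i, Y_i), so that the expectation of
   g (X_1, Y_1) is the one of [fun w => g (w.1, w.2)] under [law]. *)
Section kernel_estimation.
Context {R : realType} {d : nat}.
Variable law : probability ('rV[R]_d * measurableTypeR R)%type R.
Implicit Types (l : R -> R) (K : 'rV[R]_d -> 'rV[R]_d -> R).

Definition density_fst (f : 'rV[R]_d -> R) :=
  [/\ measurable_fun [set: 'rV[R]_d] f, forall x, 0 <= f x &
      forall A, measurable A ->
        law (fst @^-1` A) = (\int[lebesgue_rV R d]_(x in A) (f x)%:E)%E].

(* [r x] is a version of E(l(Y_1) | X_1 = x). *)
Definition cond_expectation l (r : 'rV[R]_d -> R) :=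
  [/\ law.-integrable setT (fun w => (l w.2)%:E),
      measurable_fun [set: 'rV[R]_d] r,
      law.-integrable setT (fun w => (r w.1)%:E) &
      forall A, measurable A ->
        (\int[law]_(w in fst @^-1` A) (l w.2)%:E =
         \int[law]_(w in fst @^-1` A) (r w.1)%:E)%E].

Definition estimator l K n (z : 'I_n -> 'rV[R]_d * measurableTypeR R)
    (x : 'rV[R]_d) : R :=
  n%:R^-1 * \sum_(i < n) K (z i).1 x * l (z i).2.

(* The expectation may fail to be finite for [x] in a negligible set, where the
   default value of [fine] does not affect the L2 norms. *)
Definition mean_estimator l K (x : 'rV[R]_d) : R :=
  fine 'E_law[fun w => K w.1 x * l w.2].

Definition mean_L2norm_sq l K : \bar R :=
  (\int[law]_w L2norm_sq (fun x => K w.1 x * l w.2)%R)%E.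

End kernel_estimation.

(* Main.v *)
Require Import Defs.
From HB Require Import structures.
From mathcomp Require Import all_boot all_order all_algebra.
From mathcomp Require Import all_classical all_reals all_analysis.
From mathcomp Require Import measurable_realfun.
From mathcomp Require Import ring lra.
Import Order.TTheory GRing.Theory Num.Theory.
Import numFieldNormedType.Exports.

(** For each kernel the squared error expands, with zeta_j the deviation of the
    j-th weighted kernel from the mean s_K and S_j the partial sums of the zeta_j, as
    |s^_K - s|^2 = |S_n|^2 / n^2 + 2 <S_n, s_K - s> / n + |s_K - s|^2, where
    |S_n|^2 = \sum_j |zeta_j|^2 + 2 \sum_j <S_(j-1), zeta_j>.
    After truncation of the weights at a level L of order ln n, every term is a sum
    of predictable increments <psi_(j-1), zeta_j>, bounded by a multiple of
    L sqrt(m n) |psi|, and of variance at most a multiple of m L^2 |psi|^2 by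
    condition (4); an exponential supermartingale shows that such a sum exceeds
    C x L sqrt(m n) sup |psi| with probability at most exp(-x). For the degenerate
    U-statistic \sum_j <S_(j-1), zeta_j>, the partial sums are stopped when they
    exceed a deterministic level M with M^2 of order n sbar_K + m n L^2 x^2: the
    bound on the stopped sums prevents M from ever being reached, so that no
    decoupling is needed, and x L sqrt(m n) M <= theta n sbar_K + C m n L^2 x^2 / theta.
    With x = 6 ln n the union over the n kernels costs nothing, and the error term is
    of order ln^4 n / (theta n). *)

(** The truncated weights stay centered at the untruncated mean, since the risk of the statement
    contains s_K itself. The zeta_j are then only almost centered; a level L making the mean excess
    of the weights at most 1/n keeps the accumulated bias within the size of one increment. The
    scale B = L sqrt(m n) bounds one summand, while condition (4) makes the variance of one
    increment of order B^2 |psi|^2 / n. Over n steps the variance is of the order of the squared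
    bound of a single step: the largest admissible parameter in the exponential moment costs only a
    constant, and the resulting tails, linear in x, are harmless for x of order ln n. For the
    diagonal terms, E |phi|^4 <= B^2 E |phi|^2, so that their fluctuation is a small multiple of n
    sbar_K, absorbed by theta. A bound in expectation also has to handle the exceptional event,
    where the deterministic part of the crude bound grows like n^3; hence a probability of order
    n^(-4). Both suprema are dominated by multiples of one measurable function that does not depend
    on K. *)

Set Implicit Arguments.
Unset Strict Implicit.
Unset Printing Implicit Defensive.

Local Open Scope classical_set_scope.
Local Open Scope ring_scope.

(** * Independence and the past of an i.i.d. sample *)

Section tuple_boxes.
Context {dT} {T : measurableType dT} (n : nat).

Definition box (A : 'I_n -> set T) : set (n.-tuple T) :=
  [set t | forall i, A i (tnth t i)].

Definition boxes : set (set (n.-tuple T)) :=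
  [set B | exists2 A, forall i, measurable (A i) & B = box A].

Lemma measurable_box (A : 'I_n -> set T) :
  (forall i, measurable (A i)) -> measurable (box A).
Proof.
move=> mA; have -> : box A =
    \bigcap_(i in [set: 'I_n]) ((tnth (T:=T))^~ i @^-1` A i).
  by apply/seteqP; split => t /= At i; [move=> _|]; exact: At.
apply: fin_bigcap_measurable => // i _.
by rewrite -[X in measurable X]setTI; exact: measurable_tnth.
Qed.

Lemma measurable_tuple_boxes : @measurable _ (n.-tuple T) = <<s boxes >>.
Proof.
apply/seteqP; split; last first.
  apply: smallest_sub => [|_ [A mA ->]]; last exact: measurable_box.
  exact: sigma_algebra_measurable.
apply: smallest_sub; first exact: smallest_sigma_algebra.
move=> B; rewrite -bigcup_seq => -[i _ [Y mY <-]] {B}.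
apply: sub_sigma_algebra; exists (fun j => if j == i then Y else setT).
  by move=> j; case: ifP.
rewrite setTI; apply/seteqP; split => t /= => [Yt j|].
  by case: eqP => // ->.
by move/(_ i); rewrite eqxx.
Qed.

(** Boxes are stable under intersection and generate the sigma-algebra, so uniqueness of finite
    measures on a pi-system applies. *)
Lemma eq_measure_boxes {R : realType} (m1 m2 : {measure set (n.-tuple T) -> \bar R}) :
  (m1 setT < +oo)%E ->
  (forall A, (forall i, measurable (A i)) -> m1 (box A) = m2 (box A)) ->
  forall X, measurable X -> m1 X = m2 X.
Proof.
move=> m1oo m12; apply: (@measure_unique _ R _ boxes (fun=> setT)) => //.
- exact: measurable_tuple_boxes.
- move=> _ _ [A mA ->] [A' mA' ->]; exists (fun i => A i `&` A' i).
    by move=> i; exact: measurableI.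
  apply/seteqP; split => [t [At A't] i|t AA't]; first by split.
  by split=> i; have [] := AA't i.
- move=> _; exists (fun=> setT) => //.
  by apply/seteqP; split.
- by rewrite bigcup_const.
- by move=> _ [A mA ->]; exact: m12.
Qed.

End tuple_boxes.

Section independence.
Context {R : realType} {dO dT} {Omega : measurableType dO}
  {T : measurableType dT} (P : probability Omega R) (law : probability T R)
  (n : nat) (Z : 'I_n -> {mfun Omega >-> T}).
Hypothesis iidZ : iid_sample P law Z.

Definition sample w : n.-tuple T := [tuple Z i w | i < n].

Lemma measurable_sample : measurable_fun setT sample.
Proof.
apply/measurable_fun_tnthP => i.
by rewrite (_ : _ \o _ = Z i)//; apply/funext => w; rewrite /= tnth_mktuple.
Qed.

HB.instance Definition _ :=
  isMeasurableFun.Build _ _ _ _ sample measurable_sample.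

Variable t0 : T.

(** Coordinates not yet observed are replaced by the fixed point [t0], so that the pasts at all
    times share the type of the full sample. *)
Definition past (k : nat) w : n.-tuple T :=
  [tuple if (i < k)%N then Z i w else t0 | i < n].

Lemma measurable_past k : measurable_fun setT (past k).
Proof.
apply/measurable_fun_tnthP => i.
rewrite (_ : _ \o _ = fun w => if (i < k)%N then Z i w else t0).
  by case: (i < k)%N.
by apply/funext => w; rewrite /= tnth_mktuple.
Qed.

HB.instance Definition _ k :=
  isMeasurableFun.Build _ _ _ _ (past k) (@measurable_past k).

Definition past_next (k : 'I_n) w := (past k w, Z k w).

Lemma measurable_past_next k : measurable_fun setT (past_next k).
Proof. by apply: measurable_fun_pair => //; exact: measurable_past. Qed.

HB.instance Definition _ k :=
  isMeasurableFun.Build _ _ _ _ (past_next k) (@measurable_past_next k).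

Lemma past_next_box (k : 'I_n) A B : (forall i, measurable (A i)) ->
  measurable B ->
  P (past k @^-1` box A `&` Z k @^-1` B) = (P (past k @^-1` box A) * law B)%E.
Proof.
move=> mA mB; have [Zindep Zlaw] := iidZ.
(* From time [k] on, a box only tests whether it contains [t0]; if it does not, the event is empty
   and both sides vanish. *)
have [At0|] := pselect (forall i : 'I_n, (k <= i)%N -> A i t0); last first.
  move=> /existsNP[i] /not_implyP[ki NA].
  have -> : past k @^-1` box A = set0.
    rewrite -subset0 => w /= /(_ i).
    by rewrite tnth_mktuple ltnNge ki.
  by rewrite set0I measure0 mul0e.
have pastE : past k @^-1` box A =
    [set w | forall i : 'I_n, i \in [set i : 'I_n | (i < k)%N]%SET -> A i (Z i w)].
  apply/seteqP; split => w /= + i => /(_ i).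
    by move=> Aw; rewrite inE => ik; move: Aw; rewrite tnth_mktuple ik.
  by move=> Aw; rewrite tnth_mktuple; case: ltnP => ki; [apply: Aw; rewrite inE|exact: At0].
pose A' i := if i == k then B else A i.
have mA' i : measurable (A' i) by rewrite /A'; case: ifP.
have -> : past k @^-1` box A `&` Z k @^-1` B =
    [set w | forall i : 'I_n, i \in [set i : 'I_n | (i <= k)%N]%SET -> A' i (Z i w)].
  rewrite pastE; apply/seteqP; split => w /=.
    move=> [Aw Bw] i; rewrite inE /A'; case: eqP => [-> //|/eqP ik ik'].
    by apply: Aw; rewrite inE ltn_neqAle ik' andbT.
  move=> A'w; split.
    move=> i; rewrite inE => ik; have := A'w i; rewrite inE /A' (ltnW ik).
    by move=> /(_ isT); rewrite ifF//; apply/negbTE; rewrite neq_ltn ik.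
  by have := A'w k; rewrite inE /A' eqxx leqnn; exact.
rewrite pastE !Zindep// (bigD1 k) ?inE//= muleC; congr (_ * _)%E.
  apply: eq_big => [i|i]; first by rewrite !inE ltn_neqAle andbC.
  by rewrite !inE /A' => /andP[_ /negbTE ->].
by rewrite /A' eqxx -(Zlaw k B mB).
Qed.

Lemma distribution_past_next (k : 'I_n) X : measurable X ->
  distribution P (past_next k) X = (distribution P (past k) \x law)%E X.
Proof.
move=> mX; apply/esym; apply: product_measure_unique mX => A B mA mB.
have mZB : measurable (Z k @^-1` B).
  by rewrite -[X in measurable X]setTI; exact: measurable_funPT.
have lB_fin : law B \is a fin_num by exact: fin_num_measure.
(* For fixed [B] both sides are finite measures in [A]: the restriction of [P] to the event that
   [Z k] is in [B], and a multiple of the law of the past. They need only be compared on boxes. *)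
pose c : {nonneg R} := NngNum (fine_ge0 (measure_ge0 law B)).
have cE : c%:num%:E = law B by rewrite /= fineK.
pose m1 := pushforward (mrestr P mZB) (past k).
pose m2 := mscale c (distribution P (past k)).
have m12 : m1 A = m2 A.
  apply: (@eq_measure_boxes _ _ _ R m1 m2) => //.
    change (P (setT `&` Z k @^-1` B) < +oo)%E; rewrite setTI.
    by apply: le_lt_trans (probability_le1 _ _) (ltry _).
  move=> {}A {}mA.
  change (m1 (box A) = (c%:num%:E * distribution P (past k) (box A))%E).
  by rewrite cE muleC; exact: past_next_box.
apply: etrans m12 _; change (m2 A) with (c%:num%:E * distribution P (past k) A)%E.
by rewrite cE muleC.
Qed.

(* [Z k] may be replaced by an independent copy in a function of the sample
   that depends on it only through the variables before time [k]. *)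
Lemma integral_next (k : 'I_n) (F : n.-tuple T * T -> \bar R) :
  measurable_fun setT F -> (forall p, 0 <= F p)%E ->
  (forall t t' z, (forall i : 'I_n, (i < k)%N -> tnth t i = tnth t' i) ->
     F (t, z) = F (t', z)) ->
  (\int[P]_w F (sample w, Z k w) = \int[P]_w \int[law]_z F (sample w, z))%E.
Proof.
move=> mF F0 Fpast.
have Fs w z : F (sample w, z) = F (past k w, z).
  by apply: Fpast => i ik; rewrite !tnth_mktuple ik.
transitivity (\int[P]_w (F \o past_next k) w)%E.
  by apply: eq_integral => w _; exact: Fs.
rewrite -ge0_integral_distribution//.
rewrite (eq_measure_integral (distribution P (past k) \x law)%E); last first.
  by move=> X mX _; exact: distribution_past_next.
rewrite fubini_tonelli1//.
rewrite ge0_integral_distribution//=.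
- apply: eq_integral => w _; rewrite /fubini_F.
  by apply: eq_integral => z _; rewrite -Fs.
- exact: measurable_fun_fubini_tonelli_F.
- by move=> t; apply: integral_ge0.
Qed.

End independence.

(** * An exponential supermartingale *)

(** Squaring 1 - x/2 <= exp(-x/2) gives exp(x) (1 - x/2)^2 <= 1, which leaves a polynomial
    inequality with an explicit factorization. *)
Lemma expR_le_quad {R : realType} (x : R) : x <= 1 ->
  expR x <= 1 + x + 2 * x ^+ 2.
Proof.
move=> x1; have h0 : 0 < 1 - x / 2 by lra.
have h1 : 1 - x / 2 <= expR (- (x / 2)).
  by have := expR_ge1Dx (- (x / 2)).
have h2 : expR x * (1 - x / 2) ^+ 2 <= 1.
  rewrite -[leRHS](expRxMexpNx_1 x) ler_pM2l ?expR_gt0//.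
  rewrite [in leRHS](_ : - x = - (x / 2) + - (x / 2)); last by lra.
  by rewrite expRD -expr2 ler_sqr ?nnegrE ?expR_ge0 ?(ltW h0).
have h3 : 1 <= (1 + x + 2 * x ^+ 2) * (1 - x / 2) ^+ 2.
  rewrite -subr_ge0 (_ : _ - _ = x ^+ 2 * ((1 - x) * (5 / 2 - x)) / 2).
    by rewrite divr_ge0// mulr_ge0 ?sqr_ge0// mulr_ge0//; lra.
  by field.
by have := le_trans h2 h3; rewrite ler_pM2r// exprn_gt0.
Qed.

Section bounded_integrable.
Context {R : realType} {d} {T : measurableType d}.
Variable law : {finite_measure set T -> \bar R}.

Lemma bounded_integrable (h : T -> R) M : measurable_fun setT h ->
  (forall z, `|h z| <= M) -> law.-integrable setT (EFin \o h).
Proof.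
move=> mh hM; apply: (@measurable_bounded_integrable _ _ _ law) => //.
  by rewrite -ge0_fin_numE ?fin_num_measure.
exists M; split; first exact: num_real.
by move=> x Mx y _ /=; apply: le_trans (hM y) (ltW Mx).
Qed.
End bounded_integrable.

Section exp_moment.
Context {R : realType} {d} {T : measurableType d} (law : probability T R).

(** The quadratic bound integrates to 1 + E h + 2 E h^2 <= 1 + kappa <= exp(kappa). The mean of [h]
    enters [kappa] because truncation leaves a bias. *)
Lemma integral_expR_le (h : T -> R) (kappa : R) :
  measurable_fun setT h -> (forall z, `|h z| <= 1) ->
  (\int[law]_z h z + 2 * \int[law]_z (h z ^+ 2) <= kappa)%R ->
  (\int[law]_z (expR (h z))%:E <= (expR kappa)%:E)%E.
Proof.
move=> mh h1 hk.
have ih := bounded_integrable law mh h1.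
have mh2 : measurable_fun setT (fun z => h z ^+ 2).
  exact: measurable_funX.
have ih2 : law.-integrable setT (EFin \o (fun z => h z ^+ 2)).
  apply: (@bounded_integrable _ _ _ _ _ 1) => // z.
  by rewrite normrX expr_le1.
have i1 : law.-integrable setT (EFin \o (cst 1 : T -> R)).
  by apply: (@bounded_integrable _ _ _ _ _ 1) => // z; rewrite normr1.
pose q z := (1 + h z) + 2 * h z ^+ 2.
have iq1 : law.-integrable setT (EFin \o (fun z => 1 + h z)).
  exact: (integrableD measurableT i1 ih).
have iq2 : law.-integrable setT (EFin \o (fun z => 2 * h z ^+ 2)).
  exact: (integrableZl measurableT 2 ih2).
apply: (@le_trans _ _ (\int[law]_z (q z)%:E)%E).
  apply: ge0_le_integral => //.
  - by apply/measurable_EFinP; exact: measurableT_comp.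
  - apply/measurable_EFinP; apply: measurable_funD.
      by apply: measurable_funD.
    by apply: measurable_funM.
  - move=> z _; rewrite lee_fin; apply: expR_le_quad.
    by apply: le_trans (h1 z); exact: ler_norm.
rewrite -[leLHS]fineK; last first.
  apply: integrable_fin_num => //.
  exact: (integrableD measurableT iq1 iq2).
rewrite lee_fin.
change (\int[law]_z q z <= expR kappa)%R.
rewrite RintegralD// RintegralD//= RintegralZl//.
rewrite Rintegral_cst//= probability_setT/= mulr1.
apply: le_trans (expR_ge1Dx kappa).
by rewrite -addrA lerD2l.
Qed.

End exp_moment.

Lemma measurable_sum_cond {R : realType} {d} {T : measurableType d} I (r : seq I)
    (Q : pred I) (h : I -> T -> R) :
  (forall i, measurable_fun setT (h i)) ->
  measurable_fun setT (fun x => \sum_(i <- r | Q i) h i x).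
Proof.
by move=> mh; under eq_fun do rewrite -big_filter; exact: measurable_sum.
Qed.

Lemma sum_ord_recr {V : nmodType} n (k : nat) (kn : (k < n)%N) (F : 'I_n -> V) :
  \sum_(j < n | (j < k.+1)%N) F j =
  \sum_(j < n | (j < k)%N) F j + F (Ordinal kn).
Proof.
rewrite (bigD1 (Ordinal kn))//= addrC; congr (_ + _).
apply: eq_bigl => j; rewrite ltnS [RHS]ltn_neqAle andbC.
by congr (_ && _).
Qed.

Definition rare {R : realType} {d} {T : measurableType d} (P : probability T R)
    (x : R) (A : set T) :=
  measurable A /\ (P A <= (expR (- x))%:E)%E.

Section supermartingale.
Context {R : realType} {dO dT} {Omega : measurableType dO}
  {T : measurableType dT} (P : probability Omega R) (law : probability T R)
  (n : nat) (Z : 'I_n -> {mfun Omega >-> T}).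
Hypothesis iidZ : iid_sample P law Z.
Variables (t0 : T) (g : 'I_n -> n.-tuple T -> T -> R) (kappa : R).
Hypothesis mg : forall j, measurable_fun setT (fun p : n.-tuple T * T => g j p.1 p.2).
Hypothesis g1 : forall j t z, `|g j t z| <= 1.
Hypothesis g_past : forall (j : 'I_n) (t t' : n.-tuple T) z,
  (forall i : 'I_n, (i < j)%N -> tnth t i = tnth t' i) -> g j t z = g j t' z.
Hypothesis g_kappa : forall j t,
  \int[law]_z g j t z + 2 * \int[law]_z (g j t z ^+ 2) <= kappa.

Let W (k : nat) (t : n.-tuple T) := \sum_(j < n | (j < k)%N) g j t (tnth t j).

Let measurable_W k : measurable_fun setT (W k).
Proof.
apply: measurable_sum_cond => j.
rewrite (_ : (fun _ => _) = (fun p => g j p.1 p.2) \o (fun t => (t, tnth t j)))//.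
apply: measurableT_comp => //; apply: measurable_fun_pair => //.
exact: measurable_tnth.
Qed.

(** Induction on time: the last variable is replaced by an independent copy and integrated first,
    which costs a factor exp(kappa). *)
Lemma exp_supermartingale :
  (\int[P]_w (expR (\sum_(j < n) g j (sample Z w) (Z j w)))%:E
   <= (expR (n%:R * kappa))%:E)%E.
Proof.
have W_past (k : nat) t t' :
    (forall i : 'I_n, (i < k)%N -> tnth t i = tnth t' i) -> W k t = W k t'.
  move=> tt'; apply: eq_bigr => j jk; rewrite tt'//.
  by apply: g_past => i ij; rewrite tt'// (ltn_trans ij).
have main (k : nat) : (k <= n)%N ->
    (\int[P]_w (expR (W k (sample Z w)))%:E <= (expR (k%:R * kappa))%:E)%E.
  elim: k => [_|k IHk kn].
    under eq_integral do rewrite /W big_pred0// expR0.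
    by rewrite integral_cst//= probability_setT mul0r expR0 mule1.
  pose k' := Ordinal kn.
  pose F (p : n.-tuple T * T) := (expR (W k p.1 + g k' p.1 p.2))%:E.
  have mF : measurable_fun setT F.
    apply/measurable_EFinP; apply: measurableT_comp => //.
    by apply: measurable_funD => //; exact: measurableT_comp.
  have -> : (\int[P]_w (expR (W k.+1 (sample Z w)))%:E =
             \int[P]_w F (sample Z w, Z k' w))%E.
    apply: eq_integral => w _; congr (expR _)%:E.
    by rewrite /W sum_ord_recr -/k' tnth_mktuple.
  rewrite (integral_next iidZ t0)//; last 2 first.
  - by move=> p; rewrite lee_fin expR_ge0.
  - move=> t t' z tt'; rewrite /F/= (W_past k t t')//; congr (expR (_ + _))%:E.
    exact: g_past.
  rewrite -natr1 mulrDl mul1r expRD EFinM.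
  apply: (@le_trans _ _ (\int[P]_w ((expR (W k (sample Z w)))%:E * (expR kappa)%:E))%E).
    apply: ge0_le_integral => //.
    - by move=> w _; apply: integral_ge0 => z _; rewrite lee_fin expR_ge0.
    - apply: (@measurableT_comp _ _ _ _ _ _ (fubini_F law F) _ (sample Z)); last first.
        exact: measurable_sample.
      by apply: (@measurable_fun_fubini_tonelli_F _ _ _ _ _ law F mF) => p;
        rewrite lee_fin expR_ge0.
    - apply: emeasurable_funM => //; apply/measurable_EFinP.
      apply: measurableT_comp => //.
      by apply: (measurableT_comp (measurable_W k)); exact: measurable_sample.
    move=> w _; rewrite /F/=.
    under eq_integral do rewrite expRD EFinM.
    have mgk : measurable_fun setT (g k' (sample Z w)).
      rewrite (_ : g _ _ = (fun p => g k' p.1 p.2) \o (pair (sample Z w)))//.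
      exact: measurableT_comp.
    rewrite ge0_integralZl//; last first.
      by apply/measurable_EFinP; exact: measurableT_comp.
    rewrite lee_pmul2l// ?lte_fin ?expR_gt0//.
    exact: integral_expR_le.
  rewrite ge0_integralZr//; last first.
    apply/measurable_EFinP; apply: measurableT_comp => //.
    by apply: (measurableT_comp (measurable_W k)); exact: measurable_sample.
  by rewrite lee_pmul2r ?lte_fin ?expR_gt0// IHk// ltnW.
have := main n (leqnn n).
congr (_ <= _)%E; apply: eq_integral => w _; congr (expR _)%:E.
rewrite /W; apply: eq_big => [j|j _]; first by rewrite ltn_ord.
by rewrite tnth_mktuple.
Qed.

(** Markov's inequality for the exponential of the sum. *)
Lemma supermartingale_tail (x : R) :
  rare P x [set w | n%:R * kappa + x <= \sum_(j < n) g j (sample Z w) (Z j w)].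
Proof.
set S := fun w => \sum_(j < n) g j (sample Z w) (Z j w).
have mS : measurable_fun setT S.
  apply: measurable_sum => j.
  rewrite (_ : (fun _ => _) =
    (fun p => g j p.1 p.2) \o (fun w => (sample Z w, Z j w)))//.
  by apply: measurableT_comp => //; exact: measurable_fun_pair.
have mA : measurable [set w | n%:R * kappa + x <= S w].
  rewrite -[X in measurable X]setTI (_ : [set _ | _] = S @^-1` `[n%:R * kappa + x, +oo[).
    exact: mS.
  by apply/seteqP; split => w /=; rewrite in_itv/= andbT.
split=> //; rewrite -(@lee_pmul2l _ (expR (n%:R * kappa + x))%:E) ?lte_fin ?expR_gt0//.
rewrite -EFinM -expRD addrK.
apply: le_trans exp_supermartingale.
set A := [set w | _] in mA *.
have -> : P A = (\int[P]_w (\1_A w)%:E)%E by rewrite integral_indic// setIT.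
rewrite -ge0_integralZl//; last first.
  by apply/measurable_EFinP; exact: measurable_indic.
apply: ge0_le_integral => //.
- by apply: emeasurable_funM => //; apply/measurable_EFinP; exact: measurable_indic.
- by apply/measurable_EFinP; exact: measurableT_comp.
move=> w _; rewrite -EFinM lee_fin indicE.
case: (boolP (w \in _)) => [|_]; last by rewrite mulr0 expR_ge0.
by rewrite inE /= mulr1 ler_expR.
Qed.

End supermartingale.

(** * Concentration of the squared error in a semi-inner product space *)

Lemma measurable_set_ler {R : realType} {d} {T : measurableType d} (f g : T -> R) :
  measurable_fun setT f -> measurable_fun setT g -> measurable [set w | f w <= g w].
Proof.
move=> mf mg.
rewrite -[X in measurable X]setTI.
rewrite (_ : [set w | _] = (fun w => f w <= g w) @^-1` [set true]).
  exact: measurable_fun_ler.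
by apply/seteqP; split => w /=; case: (_ <= _).
Qed.

(** The real inequality behind the deviation of one kernel: [SX] stands for the sum of squared
    norms, [N] for the degenerate U-statistic, [Wa] and [Wp] for the linear sums against the mean
    and the bias, [D] for the norm of the bias and [a2] for the squared norm of the mean. Products
    with [M] or [D] are split by the weighted arithmetic-geometric inequality, each taking a
    fraction of theta times the risk. *)
Lemma deviation_arith {R : realType} (n sigma B x theta M D N Wa Wp SX a2 : R) :
  1 <= n -> 0 <= sigma -> 0 < B -> 3 <= x -> 0 < theta < 1 -> 0 <= M -> 0 <= D ->
  M ^+ 2 = 4 * (n * sigma) + 100 * (B * x) ^+ 2 ->
  `|N| <= 4 * B * M * x -> `|Wa| <= 4 * B ^+ 2 * x ->
  `|Wp| <= 4 * B * (D + B / n) * x -> 0 <= n * a2 <= B ^+ 2 ->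
  SX <= (1 + theta / 4) * (n * sigma) + 8 * (x * B ^+ 2 / theta) ->
  (1 - theta / 4) * (n * sigma) - B ^+ 2 - 8 * (x * B ^+ 2 / theta) <= SX ->
  `|(SX - 2 * Wa - n * a2 + 2 * N) / n ^+ 2 + 2 * Wp / n - sigma / n| <=
    theta * (D ^+ 2 + sigma / n) + 400 * (B * x) ^+ 2 / (theta * n ^+ 2).
Proof.
move=> n1 s0 B0 x3 /andP[th0 th1] M0 D0 M2 hN hWa hWp /andP[a0 aB] hX1 hX2.
have n0 : 0 < n by lra.
have thn : theta != 0 by rewrite gt_eqF.
have nn : n != 0 by rewrite gt_eqF.
set c := B * x in M2 *.
pose p := c ^+ 2 / theta.
have B20 : 0 <= B ^+ 2 by rewrite sqr_ge0.
have B2xc : B ^+ 2 * x <= c ^+ 2.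
  rewrite /c exprMn ler_wpM2l// expr2 ler_peMl//; lra.
have B2c : B ^+ 2 <= c ^+ 2.
  by apply: le_trans B2xc; rewrite ler_peMr//; lra.
have cp : c ^+ 2 <= p by rewrite /p ler_pdivlMr// ler_piMr ?sqr_ge0 ?ltW.
have xp : x * B ^+ 2 / theta <= p.
  by rewrite /p ler_pM2r ?invr_gt0// mulrC B2xc.
have cB : c * B <= p.
  apply: le_trans cp; apply: le_trans B2xc; rewrite /c; lra.
(* By the value of [M ^+ 2], the term theta / 16 * M^2 is theta / 4 * (n sigma) plus at most 6.25 p;
   hence 263, above 256 + 6.25. *)
have q1 : 8 * c * M <= theta / 4 * (n * sigma) + 263 * p.
  have : 0 <= (theta * M - 64 * c) ^+ 2 / (16 * theta).
    by rewrite divr_ge0 ?sqr_ge0// mulr_ge0// ltW.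
  rewrite (_ : _ / _ = theta / 16 * M ^+ 2 + 256 * p - 8 * c * M); last first.
    by rewrite /p; field.
  rewrite M2 => h.
  have : theta * c ^+ 2 <= p by apply: le_trans cp; rewrite ler_piMl ?sqr_ge0 ?ltW.
  by lra.
have q2 : 8 * c * (n * D) <= theta / 2 * (n * D) ^+ 2 + 32 * p.
  have : 0 <= (theta * (n * D) - 8 * c) ^+ 2 / (2 * theta).
    by rewrite divr_ge0 ?sqr_ge0// mulr_ge0// ltW.
  rewrite (_ : _ / _ = theta / 2 * (n * D) ^+ 2 + 32 * p - 8 * c * (n * D)); last first.
    by rewrite /p; field.
  by lra.
have hnWp : `|n * Wp| <= 4 * c * (n * D) + 4 * (c * B).
  rewrite normrM (gtr0_norm n0).
  have -> : 4 * c * (n * D) + 4 * (c * B) = n * (4 * B * (D + B / n) * x).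
    by rewrite /c; field.
  by rewrite ler_pM2l.
have n20 : 0 < n ^+ 2 by rewrite exprn_gt0.
have E : (SX - 2 * Wa - n * a2 + 2 * N) / n ^+ 2 + 2 * Wp / n - sigma / n =
  ((SX - 2 * Wa - n * a2 + 2 * N) + 2 * (n * Wp) - n * sigma) / n ^+ 2 by field.
have E' : theta * (D ^+ 2 + sigma / n) + 400 * c ^+ 2 / (theta * n ^+ 2) =
  (theta * (n * D) ^+ 2 + theta * (n * sigma) + 400 * p) / n ^+ 2.
  by rewrite /p; field; rewrite thn nn.
rewrite E E' normrM normfV (gtr0_norm n20) ler_pM2r ?invr_gt0//.
have p0 : 0 <= p by rewrite divr_ge0 ?sqr_ge0// ltW.
have t1 : 0 <= theta * (n * D) ^+ 2 by rewrite mulr_ge0 ?sqr_ge0// ltW.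
have t2 : 0 <= theta * (n * sigma) by rewrite mulr_ge0 ?mulr_ge0// ltW.
have hN' : `|N| <= 4 * c * M by apply: le_trans hN _; rewrite /c; lra.
move: hN' hWa hnWp; rewrite !ler_norml => /andP[N1 N2] /andP[Wa1 Wa2] /andP[W1 W2].
(* The remainders add up to at most 321 p, within the 400 p available; theta is spent as 1/4 + 1/4
   on n sigma and 1/2 on (n D)^2. *)
by apply/andP; split; lra.
Qed.

Lemma union_bound {R : realType} {d} {T : measurableType d} (P : probability T R)
    (N : nat) (E : nat -> set T) (e : R) :
  (forall i, (i < N)%N -> measurable (E i) /\ (P (E i) <= e%:E)%E) ->
  (P (\big[setU/set0]_(i < N) E i) <= (N%:R * e)%:E)%E.
Proof.
elim: N => [_|N IHN EN]; first by rewrite big_ord0 measure0 mul0r.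
rewrite big_ord_recr/= -natr1 mulrDl mul1r EFinD.
have EN' i : (i < N)%N -> measurable (E i) /\ (P (E i) <= e%:E)%E.
  by move=> iN; apply: EN; rewrite ltnS ltnW.
have [mN PN] := EN N (ltnSn N).
apply: le_trans (measureU2 _ _ _) _ => //.
  by apply: bigsetU_measurable => i _; have [] := EN' i (ltn_ord i).
by rewrite leeD// IHN.
Qed.

(** * Algebra of semi-inner products *)

Section semi_inner_product.
Context {R : realType} {V : lmodType R}.
Variable dot : V -> V -> R.

(** Definiteness is left out because the vectors will be square-integrable functions, not classes
    modulo almost everywhere equality. *)
Definition semi_inner_product := [/\ forall u v, dot u v = dot v u,
  forall u v w, dot (u + v) w = dot u w + dot v w,
  forall c u v, dot (c *: u) v = c * dot u v &
  forall u, 0 <= dot u u].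

Hypothesis dotP : semi_inner_product.

Let dotC u v : dot u v = dot v u. Proof. by case: dotP. Qed.
Let dotDl u v w : dot (u + v) w = dot u w + dot v w. Proof. by case: dotP. Qed.
Let dotZl c u v : dot (c *: u) v = c * dot u v. Proof. by case: dotP. Qed.
Let dot_ge0 u : 0 <= dot u u. Proof. by case: dotP. Qed.

Lemma dotDr u v w : dot w (u + v) = dot w u + dot w v.
Proof. by rewrite dotC dotDl !(dotC w). Qed.

Lemma dotZr c u v : dot v (c *: u) = c * dot v u.
Proof. by rewrite dotC dotZl dotC. Qed.

Lemma dot0l v : dot 0 v = 0.
Proof. by rewrite -(scale0r 0) dotZl mul0r. Qed.

Lemma dotNl u v : dot (- u) v = - dot u v.
Proof. by rewrite -scaleN1r dotZl mulN1r. Qed.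

Lemma dotNr u v : dot u (- v) = - dot u v.
Proof. by rewrite -scaleN1r dotZr mulN1r. Qed.

Lemma dot_suml I (r : seq I) (Q : pred I) F v :
  dot (\sum_(i <- r | Q i) F i) v = \sum_(i <- r | Q i) dot (F i) v.
Proof. by apply: (big_morph (dot^~ v)) => [u w|]; rewrite ?dotDl ?dot0l. Qed.

Lemma dot_sqrD u v : dot (u + v) (u + v) = dot u u + dot v v + 2 * dot u v.
Proof. by rewrite dotDl !dotDr (dotC v u); ring. Qed.

Lemma dot_sqrB u v : dot (u - v) (u - v) = dot u u + dot v v - 2 * dot u v.
Proof. by rewrite dot_sqrD !dotNl !dotNr; ring. Qed.

Lemma dot_cauchy_schwarz u v : dot u v ^+ 2 <= dot u u * dot v v.
Proof.
(* If [v] is null, the squared norm of u + c v is affine in c, and would take the value -1 for some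
   c if [dot u v] were nonzero. *)
have [v0|v0] := eqVneq (dot v v) 0.
  rewrite v0 mulr0 real_exprn_even_le0 ?num_real//=; apply/eqP.
  have q (c : R) : 0 <= dot u u + 2 * c * dot u v.
    have := dot_ge0 (u + c *: v).
    by rewrite dot_sqrD !dotZl !dotZr v0 !mulr0 addr0 mulrA.
  apply/eqP/negPn/negP => uv0.
  have := q (- (dot u u + 1) / (2 * dot u v)).
  rewrite (_ : _ + _ = - 1) ?ler0N1//.
  by field.
have vp : 0 < dot v v by rewrite lt0r v0 dot_ge0.
have := dot_ge0 (dot v v *: u - dot u v *: v).
rewrite dot_sqrB !dotZl !dotZr.
rewrite (_ : _ - _ = dot v v * (dot u u * dot v v - dot u v ^+ 2)); last by ring.
by rewrite pmulr_rge0// subr_ge0.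
Qed.

Lemma dot_le u v (M N : R) : 0 <= M -> 0 <= N -> dot u u <= M ^+ 2 ->
  dot v v <= N ^+ 2 -> `|dot u v| <= M * N.
Proof.
move=> M0 N0 uM vN.
rewrite -ler_sqr ?nnegrE ?mulr_ge0// real_normK ?num_real//.
by rewrite exprMn (le_trans (dot_cauchy_schwarz u v))// ler_pM.
Qed.

End semi_inner_product.

Section concentration.
Context {R : realType} {dO dT} {Omega : measurableType dO}
  {T : measurableType dT} (P : probability Omega R) (law : probability T R)
  (n : nat) (Z : 'I_n -> {mfun Omega >-> T}).
Hypothesis n_gt0 : (0 < n)%N.
Hypothesis iidZ : iid_sample P law Z.
Variables (t0 : T) (V : lmodType R) (dot : V -> V -> R).
Hypothesis dotP : semi_inner_product dot.
(** [phi] will be the truncated weighted kernel, whereas [a] and [sigma] will be the mean and the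
    mean squared norm before truncation. This is why [bias_le], [sigma_ge] and [sigma_le] are
    inequalities with an error term and not identities. *)
Variables (phi : T -> V) (a s : V) (B sigma : R).

Local Notation zeta := (fun z => phi z - a).

Hypothesis B_gt0 : 0 < B.
Hypothesis measurable_dot : forall u, measurable_fun setT (fun z => dot u (phi z)).
Hypothesis measurable_gram :
  measurable_fun setT (fun p : T * T => dot (phi p.1) (phi p.2)).
Hypothesis phi_le : forall z, dot (phi z) (phi z) <= B ^+ 2.
Hypothesis a_le : n%:R * dot a a <= B ^+ 2.
Hypothesis variance_le : forall u,
  \int[law]_z (dot u (phi z) ^+ 2) <= B ^+ 2 / n%:R * dot u u.
Hypothesis bias_le : forall u M, 0 <= M -> dot u u <= M ^+ 2 ->
  `|\int[law]_z dot u (zeta z)| <= B / n%:R * M.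
Hypothesis sigma_ge : \int[law]_z dot (phi z) (phi z) <= sigma.
Hypothesis sigma_le : sigma <= \int[law]_z dot (phi z) (phi z) + B ^+ 2 / n%:R.

Let n0 : 0 < n%:R :> R. Proof. by rewrite ltr0n. Qed.
Let n1 : 1 <= n%:R :> R. Proof. by rewrite ler1n. Qed.

Let dotC u v : dot u v = dot v u. Proof. by case: dotP. Qed.
Let dotDl u v w : dot (u + v) w = dot u w + dot v w. Proof. by case: dotP. Qed.
Let dotZl c u v : dot (c *: u) v = c * dot u v. Proof. by case: dotP. Qed.
Let dot_ge0 u : 0 <= dot u u. Proof. by case: dotP. Qed.

Let a_leB : dot a a <= B ^+ 2.
Proof. by apply: le_trans a_le; rewrite ler_peMl. Qed.

Let zeta_le z : dot (zeta z) (zeta z) <= (2 * B) ^+ 2.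
Proof.
have h : `|dot (phi z) a| <= B * B by apply: (dot_le dotP) => //; exact: ltW.
rewrite (dot_sqrB dotP); have := phi_le z; have := a_leB.
by move: h; rewrite ler_norml => /andP[h _]; lra.
Qed.

Let measurable_dot_zeta u : measurable_fun setT (fun z => dot u (zeta z)).
Proof.
under eq_fun do rewrite (dotDr dotP) (dotNr dotP).
by apply: measurable_funB.
Qed.

Let measurable_gram_zeta :
  measurable_fun setT (fun p : T * T => dot (zeta p.1) (zeta p.2)).
Proof.
under eq_fun do rewrite (dotDr dotP) !dotDl !(dotNr dotP) !(dotNl dotP) (dotC _ a).
apply: measurable_funD; apply: measurable_funD => //.
- by apply: measurable_funN; exact: (measurableT_comp (measurable_dot a)).
- by apply: measurable_funN; exact: (measurableT_comp (measurable_dot a)).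
Qed.

(* Cauchy-Schwarz only bounds the increments by [2 * B * M]; that their variance
   is smaller by a factor [n] is the content of [variance_le]. *)
Lemma predictable_tail (psi : 'I_n -> n.-tuple T -> V) (M x : R) :
  0 < M ->
  (forall j, measurable_fun setT
    (fun p : n.-tuple T * T => dot (psi j p.1) (zeta p.2))) ->
  (forall (j : 'I_n) (t t' : n.-tuple T),
    (forall i : 'I_n, (i < j)%N -> tnth t i = tnth t' i) -> psi j t = psi j t') ->
  (forall j t, dot (psi j t) (psi j t) <= M ^+ 2) ->
  rare P x [set w | 2 * B * M * (3 + x) <=
        \sum_(j < n) dot (psi j (sample Z w)) (zeta (Z j w))].
Proof.
move=> M0 mpsi psi_past psiM.
have BM : 0 < 2 * B * M by rewrite !mulr_gt0.
(* The largest factor for which Cauchy-Schwarz keeps the increments in [-1, 1]. *)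
pose lam := (2 * B * M)^-1.
have lam0 : 0 < lam by rewrite invr_gt0.
pose g j t z := lam * dot (psi j t) (zeta z).
have mg j : measurable_fun setT (fun p : n.-tuple T * T => g j p.1 p.2).
  by apply: measurable_funM => //; exact: mpsi.
have g1 j t z : `|g j t z| <= 1.
  rewrite /g normrM (gtr0_norm lam0) mulrC ler_pdivrMr// mul1r.
  rewrite (_ : 2 * B * M = M * (2 * B)); last by ring.
  apply: (dot_le dotP) => //; first exact: ltW.
  by rewrite mulr_ge0 ?ltW.
(* The bias gives 1 / (2 n) and the second moment, split between [phi] and [a], gives twice 1 / n.
   Over n steps the bound 3 / n becomes the 3 of [3 + x]. *)
have gk j t : \int[law]_z g j t z + 2 * \int[law]_z (g j t z ^+ 2) <= 3 / n%:R.
  have mz := measurable_dot_zeta (psi j t).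
  have iz : law.-integrable setT (EFin \o (fun z => dot (psi j t) (zeta z))).
    apply: (@bounded_integrable _ _ _ _ _ (M * (2 * B))) => // z.
    by apply: (dot_le dotP) => //; [exact: ltW|rewrite mulr_ge0 ?ltW].
  have h1 : \int[law]_z g j t z <= 1 / (2 * n%:R).
    rewrite RintegralZl//.
    have := bias_le (ltW M0) (psiM j t).
    rewrite ler_norml => /andP[_ h].
    apply: le_trans (ler_wpM2l (ltW lam0) h) _.
    rewrite (_ : lam * _ = 1 / (2 * n%:R))// /lam; field.
    by rewrite !gt_eqF.
  have mphi2 : measurable_fun setT (fun z => dot (psi j t) (phi z) ^+ 2).
    exact: measurable_funX.
  have iphi2 : law.-integrable setT (EFin \o (fun z => dot (psi j t) (phi z) ^+ 2)).
    apply: (@bounded_integrable _ _ _ _ _ ((M * B) ^+ 2)) => // z.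
    rewrite normrX lerXn2r ?nnegrE ?mulr_ge0 ?(ltW M0) ?(ltW B_gt0)//.
    by apply: (dot_le dotP) => //; exact: ltW.
  have h2 : \int[law]_z (g j t z ^+ 2) <= 1 / n%:R.
    pose q z := (2 * lam ^+ 2) * (dot (psi j t) (phi z) ^+ 2)
      + 2 * lam ^+ 2 * (dot (psi j t) a ^+ 2).
    have ic : law.-integrable setT
        (EFin \o (fun _ : T => 2 * lam ^+ 2 * (dot (psi j t) a ^+ 2))).
      exact: (@bounded_integrable _ _ _ _ _ `|2 * lam ^+ 2 * (dot (psi j t) a ^+ 2)|).
    have iq1 : law.-integrable setT
        (EFin \o (fun z => 2 * lam ^+ 2 * (dot (psi j t) (phi z) ^+ 2))).
      exact: (integrableZl measurableT _ iphi2).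
    apply: (@le_trans _ _ (\int[law]_z q z)).
      apply: le_Rintegral => //.
      - apply: (@bounded_integrable _ _ _ _ _ 1) => [|z].
          by apply: measurable_funX; exact: measurable_funM.
        by rewrite normrX expr_le1.
      - exact: (integrableD measurableT iq1 ic).
      move=> z _; rewrite /g /q (dotDr dotP) (dotNr dotP).
      rewrite -subr_ge0 (_ : _ - _ = (lam * (dot (psi j t) (phi z) + dot (psi j t) a)) ^+ 2).
        exact: sqr_ge0.
      by ring.
    rewrite RintegralD// RintegralZl// Rintegral_cst//= probability_setT/= mulr1.
    have ha : dot (psi j t) a ^+ 2 <= M ^+ 2 * (B ^+ 2 / n%:R).
      apply: le_trans (dot_cauchy_schwarz dotP _ _) _.
      by apply: ler_pM => //; rewrite ler_pdivlMr// mulrC.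
    have hp : \int[law]_z (dot (psi j t) (phi z) ^+ 2) <= M ^+ 2 * (B ^+ 2 / n%:R).
      apply: le_trans (variance_le _) _; rewrite mulrC.
      by apply: ler_wpM2r => //; rewrite divr_ge0 ?sqr_ge0// ltW.
    rewrite -mulrDr.
    apply: (@le_trans _ _ (2 * lam ^+ 2 * (2 * (M ^+ 2 * (B ^+ 2 / n%:R))))).
      apply: ler_wpM2l; first by rewrite mulr_ge0// sqr_ge0.
      by rewrite mulr_natl mulr2n lerD.
    rewrite (_ : _ * _ = 1 / n%:R)// /lam; field.
    by rewrite !gt_eqF.
  have -> : 3 / n%:R = 1 / (2 * n%:R) + 2 * (1 / n%:R) + 1 / (2 * n%:R) :> R.
    by field; rewrite gt_eqF.
  have : 0 <= 1 / (2 * n%:R) :> R by rewrite divr_ge0// mulr_ge0// ltW.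
  lra.
have g_past (j : 'I_n) (t t' : n.-tuple T) z :
    (forall i : 'I_n, (i < j)%N -> tnth t i = tnth t' i) -> g j t z = g j t' z.
  by move=> tt'; rewrite /g (psi_past j t t').
have := supermartingale_tail iidZ t0 mg g1 g_past gk x.
have nE : n%:R * (3 / n%:R) = 3 :> R by rewrite mulrC divfK// gt_eqF.
congr (rare P _ _); apply/seteqP; split => w /=.
all: by rewrite nE /g -mulr_sumr [lam * _]mulrC ler_pdivlMr// [(3 + x) * _]mulrC.
Qed.

Local Notation S k t := (\sum_(i < n | (i < k)%N) zeta (tnth t i)).

Lemma dot_sum_zeta (z : 'I_n -> T) (k : nat) : (k <= n)%N ->
  let Sz k := \sum_(i < n | (i < k)%N) zeta (z i) in
  dot (Sz k) (Sz k) = \sum_(j < n | (j < k)%N)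
    (dot (zeta (z j)) (zeta (z j)) + 2 * dot (Sz j) (zeta (z j))).
Proof.
move=> + Sz; elim: k => [_|k IHk kn].
  by rewrite /Sz !big_pred0// (dot0l dotP).
have SzS : Sz k.+1 = Sz k + zeta (z (Ordinal kn)) := sum_ord_recr kn _.
rewrite sum_ord_recr SzS (dot_sqrD dotP (Sz k)) IHk ?(ltnW kn)//.
by rewrite addrA.
Qed.

(** Both tests depend on the first [j] coordinates only, so the sequence stays predictable while
    bounded by [M]. It is not a genuine stopping: a term reappears once the partial sum is back
    below [M], which does no harm. The horizon [K] makes partial U-statistics instances of full
    sums. *)
Definition stopped (M : R) (K : nat) (j : 'I_n) (t : n.-tuple T) : V :=
  if (dot (S j t) (S j t) <= M ^+ 2) && (j < K)%N then S j t else 0.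

(** The factor [c] is there for the two values 1 and -1, one for each tail. *)
Lemma stopped_tail (M x c : R) K : 0 < M -> `|c| = 1 ->
  rare P x [set w | 2 * B * M * (3 + x) <=
        \sum_(j < n) dot (c *: stopped M K j (sample Z w)) (zeta (Z j w))].
Proof.
move=> M0 c1.
have mSS j : measurable_fun setT (fun t : n.-tuple T => dot (S j t) (S j t)).
  under eq_fun do rewrite (dot_suml dotP).
  apply: measurable_sum_cond => i.
  under eq_fun do rewrite dotC (dot_suml dotP).
  apply: measurable_sum_cond => i'.
  rewrite (_ : (fun _ => _) = (fun p : T * T => dot (zeta p.1) (zeta p.2)) \o
    (fun t : n.-tuple T => (tnth t i', tnth t i)))//.
  apply: measurableT_comp => //; apply: measurable_fun_pair; exact: measurable_tnth.
apply: (@predictable_tail (fun j t => c *: stopped M K j t)) => //.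
- move=> j; under eq_fun do rewrite dotZl.
  apply: measurable_funM => //.
  pose C (p : n.-tuple T * T) := (dot (S j p.1) (S j p.1) <= M ^+ 2) && (j < K)%N.
  rewrite (_ : (fun _ => _) =
      (fun p => if C p then dot (S j p.1) (zeta p.2) else 0)); last first.
    by apply/funext => p; rewrite /stopped -/(C p); case: (C p); rewrite ?(dot0l dotP).
  apply: measurable_fun_ifT => //.
    apply: measurable_and => //.
    apply: measurable_fun_ler => //.
    exact: (measurableT_comp (mSS j)).
  under eq_fun do rewrite (dot_suml dotP).
  apply: measurable_sum_cond => i.
  rewrite (_ : (fun _ => _) = (fun p : T * T => dot (zeta p.1) (zeta p.2)) \o
    (fun p : n.-tuple T * T => (tnth p.1 i, p.2)))//.
  apply: measurableT_comp => //; apply: measurable_fun_pair => //.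
  exact: (measurableT_comp (@measurable_tnth _ _ n i) measurable_fst).
- move=> j t t' tt'; rewrite /stopped.
  have -> // : S j t = S j t'.
  by apply: eq_bigr => i ij; rewrite tt'.
- move=> j t; rewrite dotZl (dotZr dotP) mulrA -expr2.
  rewrite -[c ^+ 2]real_normK ?num_real// c1 expr1n mul1r /stopped.
  by case: ifP => [/andP[]//|_]; rewrite (dot0l dotP) sqr_ge0.
Qed.

(** * Tails of the sum of squared norms *)

Let X z := dot (phi z) (phi z).

Let mX : measurable_fun setT X.
Proof.
rewrite (_ : X = (fun p : T * T => dot (phi p.1) (phi p.2)) \o (fun z => (z, z)))//.
by apply: measurableT_comp => //; exact: measurable_fun_pair.
Qed.

Let X_le z : `|X z| <= B ^+ 2.
Proof. by rewrite /X ger0_norm ?dot_ge0. Qed.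

Let iX : law.-integrable setT (EFin \o X).
Proof. exact: bounded_integrable X_le. Qed.

(** As [X] is at most B^2, its second moment is at most B^2 times its mean, so the quadratic term of
    the exponential bound is itself a multiple of the mean. The sign of [lam] selects the tail. *)
Lemma sqnorm_exp_tail (lam kappa x : R) : `|lam| * B ^+ 2 <= 1 ->
  lam * \int[law]_z X z + 2 * `|lam| * (`|lam| * B ^+ 2) * \int[law]_z X z <= kappa ->
  rare P x [set w | n%:R * kappa + x <= \sum_(j < n) lam * X (Z j w)].
Proof.
move=> lamB lamk.
apply: (supermartingale_tail (g := fun _ _ z => lam * X z) iidZ t0) => //.
- move=> _; apply: measurable_funM => //.
  exact: (measurableT_comp mX measurable_snd).
- move=> _ _ z; rewrite normrM (le_trans _ lamB)// ler_wpM2l//.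
move=> _ _; rewrite RintegralZl//; apply: le_trans lamk; rewrite lerD2l.
rewrite -2!mulrA ler_pM2l// mulrA.
set c := `|lam| * (`|lam| * B ^+ 2); rewrite -RintegralZl//.
apply: le_Rintegral => //.
- apply: (@bounded_integrable _ _ _ _ _ 1) => [|z].
    by apply: measurable_funX; exact: measurable_funM.
  by rewrite normrX expr_le1// normrM (le_trans _ lamB)// ler_wpM2l.
- exact: (integrableZl measurableT _ iX).
move=> z _; rewrite exprMn -[lam ^+ 2]real_normK ?num_real//.
rewrite (_ : c * X z = `|lam| ^+ 2 * (B ^+ 2 * X z)); last by rewrite /c; ring.
by rewrite ler_wpM2l ?sqr_ge0// expr2 ler_wpM2r ?dot_ge0 ?phi_le.
Qed.

Let EX_ge0 : 0 <= \int[law]_z X z.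
Proof. by apply: Rintegral_ge0 => z _; exact: dot_ge0. Qed.

(** The parameter theta / B^2 makes the quadratic term 2 theta times the linear one; dividing by it
    turns x into x B^2 / theta. *)
Lemma sqnorm_tail_ge (theta x : R) : 0 < theta <= 1 ->
  rare P x [set w | (1 + 2 * theta) * (n%:R * sigma) + x * B ^+ 2 / theta <=
        \sum_(j < n) X (Z j w)].
Proof.
move=> /andP[th0 th1].
have B20 : 0 < B ^+ 2 by rewrite exprn_gt0.
have l0 : 0 < theta / B ^+ 2 by rewrite divr_gt0.
have lB : theta / B ^+ 2 * B ^+ 2 = theta by rewrite divfK// gt_eqF.
have := @sqnorm_exp_tail (theta / B ^+ 2)
  (theta / B ^+ 2 * ((1 + 2 * theta) * sigma)) x.
rewrite (gtr0_norm l0) lB => /(_ th1); set c := theta / B ^+ 2 in l0 lB *.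
have -> : c * \int[law]_z X z + 2 * c * theta * \int[law]_z X z =
    c * ((1 + 2 * theta) * \int[law]_z X z) by ring.
move=> h; have {h} := h _; rewrite ler_pM2l// ler_wpM2l//; last first.
  by rewrite addr_ge0// mulr_ge0// ltW.
move=> /(_ isT); congr (rare P _ _).
have cx : c * (x * B ^+ 2 / theta) = x by rewrite /c; field; rewrite !gt_eqF.
have E w : (n%:R * (c * ((1 + 2 * theta) * sigma)) + x <=
      \sum_(j < n) c * X (Z j w)) =
    ((1 + 2 * theta) * (n%:R * sigma) + x * B ^+ 2 / theta <=
      \sum_(j < n) X (Z j w)).
  rewrite -mulr_sumr -[in LHS]cx -[in RHS](ler_pM2l l0); congr (_ <= _).
  by ring.
by apply/seteqP; split => w /=; rewrite E.
Qed.

(** The same parameter with the opposite sign. The loss of [B ^+ 2] is n times the truncation error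
    B^2 / n of [sigma_le]; the event of the exponential bound is slightly larger, by a term 2 theta
    B^2. *)
Lemma sqnorm_tail_le (theta x : R) : 0 < theta -> 2 * theta <= 1 ->
  rare P x [set w | \sum_(j < n) X (Z j w) <=
        (1 - 2 * theta) * (n%:R * sigma) - B ^+ 2 - x * B ^+ 2 / theta].
Proof.
move=> th0 th1.
have B20 : 0 < B ^+ 2 by rewrite exprn_gt0.
have l0 : 0 < theta / B ^+ 2 by rewrite divr_gt0.
have lB : theta / B ^+ 2 * B ^+ 2 = theta by rewrite divfK// gt_eqF.
have := @sqnorm_exp_tail (- (theta / B ^+ 2))
  (- (theta / B ^+ 2 * ((1 - 2 * theta) * (sigma - B ^+ 2 / n%:R)))) x.
rewrite normrN (gtr0_norm l0) lB; set c := theta / B ^+ 2 in l0 lB *.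
have -> : - c * \int[law]_z X z + 2 * c * theta * \int[law]_z X z =
    - (c * ((1 - 2 * theta) * \int[law]_z X z)) by ring.
have th1' : theta <= 1 by lra.
move=> /(_ th1') h.
have /h[_ {}h] : - (c * ((1 - 2 * theta) * \int[law]_z X z)) <=
    - (c * ((1 - 2 * theta) * (sigma - B ^+ 2 / n%:R))).
  by rewrite lerN2 ler_pM2l// ler_wpM2l ?subr_ge0// lerBlDr.
have cx : c * (x * B ^+ 2 / theta) = x by rewrite /c; field; rewrite !gt_eqF.
have mS : measurable_fun setT (fun w => \sum_(j < n) X (Z j w)).
  by apply: measurable_sum => j; exact: measurableT_comp.
split; first exact: measurable_set_ler.
apply: le_trans h; apply: le_measure; rewrite ?inE.
- exact: measurable_set_ler.
- apply: measurable_set_ler => //.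
  by apply: measurable_sum => j; apply: measurable_funM => //; exact: measurableT_comp.
move=> w /=; rewrite -mulr_sumr mulNr => hw.
rewrite mulrN -lerN2 opprD !opprK.
rewrite -(ler_pM2l l0) in hw.
apply: le_trans hw _; rewrite -{2}cx.
have -> : n%:R * (c * ((1 - 2 * theta) * (sigma - B ^+ 2 / n%:R))) =
  c * ((1 - 2 * theta) * (n%:R * sigma) - B ^+ 2 + 2 * theta * B ^+ 2).
  by field; rewrite gt_eqF.
rewrite -mulrBr ler_pM2l// lerD2r lerDl.
by apply: mulr_ge0; [rewrite mulr_ge0 ?ltW|exact: ltW].
Qed.

Lemma const_tail (u : V) (M x c : R) : 0 < M -> dot u u <= M ^+ 2 -> `|c| = 1 ->
  rare P x [set w | 2 * B * M * (3 + x) <=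
        \sum_(j < n) dot (c *: u) (zeta (Z j w))].
Proof.
move=> M0 uM c1; apply: (@predictable_tail (fun _ _ => c *: u)) => //.
  by move=> _; exact: (measurableT_comp (measurable_dot_zeta _) measurable_snd).
move=> _ _; rewrite dotZl (dotZr dotP) mulrA -expr2.
by rewrite -[c ^+ 2]real_normK ?num_real// c1 expr1n mul1r.
Qed.

Definition empirical_mean (z : 'I_n -> T) : V :=
  n%:R^-1 *: \sum_(j < n) phi (z j).

Definition oracle_risk := dot (a - s) (a - s) + sigma / n%:R.

(** * Deterministic analysis of a good outcome *)

Section deviation.
Variables (z : 'I_n -> T) (x theta M : R).
Hypothesis x3 : 3 <= x.
Hypothesis M0 : 0 < M.
Hypothesis M2 : M ^+ 2 = 4 * (n%:R * sigma) + 100 * (B * x) ^+ 2.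

Let Sz k := \sum_(i < n | (i < k)%N) zeta (z i).
Let SX := \sum_(j < n) X (z j).
Let Wsum u := \sum_(j < n) dot u (zeta (z j)).
Let tz : n.-tuple T := [tuple z i | i < n].

Hypothesis SX_le : SX < 2 * (n%:R * sigma) + 2 * (x * B ^+ 2).
Hypothesis Wa_le : `|Wsum a| <= 4 * B ^+ 2 * x.
Hypothesis stopped_le : forall k, (k <= n)%N ->
  \sum_(j < n) dot (stopped M k j tz) (zeta (z j)) <= 4 * B * M * x.

Let StzE (j : 'I_n) : S j tz = Sz j.
Proof. by apply: eq_bigr => i _; rewrite tnth_mktuple. Qed.

Let sum_sqnorm_zeta : \sum_(j < n) dot (zeta (z j)) (zeta (z j)) =
  SX - 2 * Wsum a - n%:R * dot a a.
Proof.
have -> : n%:R * dot a a = \sum_(j < n) dot a a.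
  by rewrite sumr_const card_ord mulr_natl.
rewrite /SX /Wsum mulr_sumr -!sumrB.
apply: eq_bigr => j _; rewrite (dot_sqrB dotP) (dotDr dotP) (dotNr dotP) (dotC a).
by rewrite /X; ring.
Qed.

(** Strong induction: if the earlier partial sums are within [M], no term before [k] has been
    suppressed, so the U-statistic up to [k] is a stopped sum with a known bound. Since 8 B x M <=
    M^2 / 2 + 32 (B x)^2, the squared norm is at most M^2 / 2 + 2 n sigma + 42 (B x)^2. The
    constants 4 and 100 in [M2] make M^2 / 2 = 2 n sigma + 50 (B x)^2, which closes the
    induction. *)
Lemma sqnorm_partial_sum_le (k : nat) : (k <= n)%N -> dot (Sz k) (Sz k) <= M ^+ 2.
Proof.
elim/ltn_ind: k => k IHk kn.
rewrite dot_sum_zeta// big_split/= -mulr_sumr.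
have -> : \sum_(j < n | (j < k)%N) dot (Sz j) (zeta (z j)) =
    \sum_(j < n) dot (stopped M k j tz) (zeta (z j)).
  rewrite [RHS](bigID (fun j : 'I_n => (j < k)%N))/= [X in _ + X]big1 ?addr0.
    apply: eq_bigr => j jk; rewrite /stopped StzE jk IHk//.
    by rewrite ltnW.
  by move=> j /negbTE jk; rewrite /stopped jk andbF (dot0l dotP).
have h1 : \sum_(j < n | (j < k)%N) dot (zeta (z j)) (zeta (z j)) <=
    SX - 2 * Wsum a - n%:R * dot a a.
  rewrite -sum_sqnorm_zeta [leRHS](bigID (fun j : 'I_n => (j < k)%N))/= lerDl.
  by apply: sumr_ge0 => j _; exact: dot_ge0.
have h2 := stopped_le kn.
have h3 : 0 <= n%:R * dot a a by rewrite mulr_ge0.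
have h4 : 0 <= (M - 8 * (B * x)) ^+ 2 by exact: sqr_ge0.
have h5 : B ^+ 2 * x <= (B * x) ^+ 2.
  rewrite exprMn ler_wpM2l ?sqr_ge0// expr2 ler_peMl//; have := x3; lra.
move: Wa_le; rewrite ler_norml => /andP[h6 h7].
have h8 : 0 <= (B * x) ^+ 2 by exact: sqr_ge0.
have h9 := SX_le; have h10 := M2.
lra.
Qed.

Lemma sqnorm_sum_stopped : dot (Sz n) (Sz n) = SX - 2 * Wsum a - n%:R * dot a a
  + 2 * \sum_(j < n) dot (stopped M n j tz) (zeta (z j)).
Proof.
rewrite dot_sum_zeta// big_split/= -mulr_sumr -sum_sqnorm_zeta; congr (_ + 2 * _).
  by apply: eq_bigl => j; rewrite ltn_ord.
apply: eq_big => j; first by rewrite ltn_ord.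
by move=> jn; rewrite /stopped StzE sqnorm_partial_sum_le ?ltn_ord// ltnW.
Qed.

Hypothesis theta01 : 0 < theta < 1.
Hypothesis stopped_ge :
  - (4 * B * M * x) <= \sum_(j < n) dot (stopped M n j tz) (zeta (z j)).
Hypothesis Was_le : `|Wsum (a - s)| <=
  4 * B * (Num.sqrt (dot (a - s) (a - s)) + B / n%:R) * x.
Hypothesis SX_ub : SX <= (1 + theta / 4) * (n%:R * sigma) + 8 * (x * B ^+ 2 / theta).
Hypothesis SX_lb :
  (1 - theta / 4) * (n%:R * sigma) - B ^+ 2 - 8 * (x * B ^+ 2 / theta) <= SX.

Lemma sqnorm_error_deviation :
  `|dot (empirical_mean z - s) (empirical_mean z - s) - oracle_risk|
  <= theta * oracle_risk + 400 * (B * x) ^+ 2 / (theta * n%:R ^+ 2).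
Proof.
set e := _ - s; set A := oracle_risk.
have sig0 : 0 <= sigma by exact: le_trans sigma_ge.
have SznE : Sz n = \sum_(j < n) zeta (z j).
  by apply: eq_bigl => j; rewrite ltn_ord.
have -> : e = n%:R^-1 *: Sz n + (a - s).
  rewrite /e /empirical_mean SznE sumrB sumr_const card_ord scalerBr.
  rewrite -[a *+ n]scaler_nat scalerA mulVf ?gt_eqF//.
  by rewrite scale1r addrA subrK.
have -> : A = Num.sqrt (dot (a - s) (a - s)) ^+ 2 + sigma / n%:R.
  by rewrite /A /oracle_risk sqr_sqrtr.
rewrite (dot_sqrD dotP (_ *: _)) !dotZl (dotZr dotP) sqnorm_sum_stopped.
have -> : dot (Sz n) (a - s) = Wsum (a - s).
  rewrite SznE (dot_suml dotP); apply: eq_bigr => j _; exact: dotC.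
set N := \sum_(j < n) dot (stopped _ _ _ _) _.
have hN : `|N| <= 4 * B * M * x by rewrite ler_norml stopped_ge stopped_le.
have ha : 0 <= n%:R * dot a a <= B ^+ 2 by rewrite a_le andbT mulr_ge0.
have := deviation_arith n1 sig0 B_gt0 x3 theta01 (ltW M0) (sqrtr_ge0 _) M2 hN Wa_le
  Was_le ha SX_ub SX_lb.
congr (`|_| <= _); rewrite sqr_sqrtr//; field.
by rewrite gt_eqF.
Qed.

End deviation.

Theorem sqnorm_error_tail (x theta : R) : 3 <= x -> 0 < theta < 1 ->
  exists2 G : set Omega,
    measurable G /\ (P (~` G) <= ((n + 9)%:R * expR (- x))%:E)%E &
    forall w, G w ->
      (`|dot (empirical_mean (fun j => Z j w) - s) (empirical_mean (fun j => Z j w) - s)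
         - oracle_risk|
       <= theta * oracle_risk + 400 * (B * x) ^+ 2 / (theta * n%:R ^+ 2))%R.
Proof.
move=> x3 theta01; have /andP[th0 th1] := theta01.
have sig0 : 0 <= sigma by exact: le_trans sigma_ge.
have Bx : 0 < B * x by rewrite mulr_gt0//; lra.
pose M := Num.sqrt (4 * (n%:R * sigma) + 100 * (B * x) ^+ 2).
have M2p : 0 < 4 * (n%:R * sigma) + 100 * (B * x) ^+ 2.
  apply: ltr_wpDl; first by rewrite mulr_ge0// mulr_ge0// ltW.
  by rewrite mulr_gt0// exprn_gt0.
have M0 : 0 < M by rewrite sqrtr_gt0.
have M2 : M ^+ 2 = 4 * (n%:R * sigma) + 100 * (B * x) ^+ 2.
  by rewrite sqr_sqrtr ?ltW.
pose D := Num.sqrt (dot (a - s) (a - s)).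
have D0 : 0 <= D by exact: sqrtr_ge0.
(* [const_tail] asks for a positive level; adding B / n provides one even when the bias vanishes. *)
have Mp0 : 0 < D + B / n%:R by rewrite ltr_wpDl// divr_gt0.
have DM : dot (a - s) (a - s) <= (D + B / n%:R) ^+ 2.
  rewrite -[leLHS]sqr_sqrtr// -/D ler_sqr ?nnegrE ?(ltW Mp0)//.
  by rewrite lerDl divr_ge0 ?(ltW B_gt0) ?(ltW n0).
(* The tails of the squared norms double their parameter, so theta / 8 yields the relative error
   theta / 4. The value 1/2 below gives the coarse upper bound on [SX] used in the induction on
   partial sums. *)
have th8 : 0 < theta / 8 <= 1 by apply/andP; split; lra.
have th8' : 2 * (theta / 8) <= 1 by lra.
have th80 : 0 < theta / 8 by lra.
have hf : 0 < (1 / 2 : R) <= 1 by apply/andP; split; lra.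
pose bad_stopped c K := [set w | 2 * B * M * (3 + x) <=
  \sum_(j < n) dot (c *: stopped M K j (sample Z w)) (zeta (Z j w))]%R.
pose bad_cst u N c := [set w | 2 * B * N * (3 + x) <=
  \sum_(j < n) dot (c *: u) (zeta (Z j w))]%R.
pose bad_ge t := [set w | (1 + 2 * t) * (n%:R * sigma) + x * B ^+ 2 / t <=
  \sum_(j < n) X (Z j w)]%R.
pose bad_le t := [set w | \sum_(j < n) X (Z j w) <=
  (1 - 2 * t) * (n%:R * sigma) - B ^+ 2 - x * B ^+ 2 / t]%R.
pose L := [:: bad_stopped (- 1) n; bad_cst (a - s) (D + B / n%:R) 1;
  bad_cst (a - s) (D + B / n%:R) (- 1); bad_cst a B 1; bad_cst a B (- 1);
  bad_ge (theta / 8); bad_le (theta / 8); bad_ge (1 / 2)].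
(* The count n + 9: one upper tail of the stopped sums for each of the n + 1 horizons, as the
   induction requires, and the eight events of [L]. *)
pose E k := if (k <= n)%N then bad_stopped 1 k else nth (bad_ge (1 / 2)) L (k - n.+1).
have P1 : (`|1 : R| = 1)%R by rewrite normr1.
have N1 : (`|- 1 : R| = 1)%R by rewrite normrN1.
have rareE i : (i < n + 9)%N -> rare P x (E i).
  move=> iN; rewrite /E; case: ifPn => [_|]; first exact: stopped_tail.
  rewrite -ltnNge => ni.
  move: (i - n.+1)%N => [|[|[|[|[|[|[|[|k]]]]]]]] /=.
  - exact: stopped_tail.
  - exact: const_tail.
  - exact: const_tail.
  - by apply: const_tail => //; rewrite B_gt0.
  - by apply: const_tail => //; rewrite B_gt0.
  - exact: sqnorm_tail_ge.
  - exact: sqnorm_tail_le.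
  - exact: sqnorm_tail_ge hf.
  (* Past the eight entries [nth] returns its default, which is again a rare event. *)
  - by rewrite nth_nil; exact: sqnorm_tail_ge hf.
pose bad := \big[setU/set0]_(i < n + 9) E i.
have mbad : measurable bad by apply: bigsetU_measurable => i _; have [] := rareE i (ltn_ord i).
exists (~` bad).
  split; first exact: measurableC.
  rewrite setCK; exact: union_bound.
move=> w /= wbad.
have notE i : (i < n + 9)%N -> ~ E i w.
  move=> iN Ew; apply: wbad; rewrite /bad -bigcup_mkord; by exists i.
(* The assumption [3 <= x] absorbs the constant 3 into a second x. *)
have xx : forall y, 0 < y -> 2 * B * y * (3 + x) <= 4 * B * y * x.
  move=> y y0; rewrite (_ : 4 * B * y * x = 2 * B * y * (2 * x)); last by ring.
  by rewrite ler_wpM2l//; [rewrite mulr_ge0 ?mulr_ge0 ?ltW|lra].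
have notL i : (i < 8)%N -> ~ (nth (bad_ge (1 / 2)) L i) w.
  move=> i8; have := @notE (n.+1 + i)%N; rewrite /E.
  have -> : (n.+1 + i <= n)%N = false.
    by apply/negbTE; rewrite -ltnNge addSn ltnS leq_addr.
  by rewrite addKn addSnnS ltn_add2l ltnS; exact.
have dotN u v : dot (- 1 *: u) v = - dot u v by rewrite dotZl mulN1r.
have cst_le u N : 0 < N -> ~ bad_cst u N 1 w -> ~ bad_cst u N (- 1) w ->
    `|\sum_(j < n) dot u (zeta (Z j w))| <= 4 * B * N * x.
  move=> N0 /negP; rewrite -ltNge => h1 /negP; rewrite -ltNge => h2.
  rewrite ler_norml; apply/andP; split.
    rewrite lerNl; apply: le_trans (xx _ N0); apply: ltW; apply: le_lt_trans h2.
    by rewrite -sumrN; under [leRHS]eq_bigr do rewrite dotN.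
  apply: le_trans (xx _ N0); apply: ltW; apply: le_lt_trans h1.
  by under [leRHS]eq_bigr do rewrite scale1r.
apply: (@sqnorm_error_deviation (fun j => Z j w) x theta M) => //.
- have /negP := notL 7 isT; rewrite -ltNge /= => h.
  by apply: lt_le_trans h _; rewrite le_eqVlt; apply/orP; left; apply/eqP; field.
- rewrite (_ : 4 * B ^+ 2 * x = 4 * B * B * x); last by ring.
  apply: cst_le => //; [exact: (notL 3)|exact: (notL 4)].
- move=> k kn; have := @notE k; rewrite /E kn addnS ltnS.
  move=> /(_ (leq_trans kn (leq_addr _ _))).
  move=> /negP; rewrite -ltNge => h; apply: le_trans (xx _ M0).
  apply: ltW; apply: le_lt_trans h.
  by under [leRHS]eq_bigr do rewrite scale1r.
- have /negP := notL 0 isT; rewrite -ltNge /= => h.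
  rewrite lerNl; apply: le_trans (xx _ M0); apply: ltW; apply: le_lt_trans h.
  by rewrite -sumrN; under [leRHS]eq_bigr do rewrite dotN.
- apply: cst_le => //; [exact: (notL 1)|exact: (notL 2)].
- have /negP := notL 5 isT; rewrite -ltNge /= => /ltW h.
  apply: le_trans h _; rewrite le_eqVlt; apply/orP; left; apply/eqP; field.
  by rewrite gt_eqF.
- have /negP := notL 6 isT; rewrite -ltNge /= => /ltW h.
  apply: le_trans h; rewrite le_eqVlt; apply/orP; left; apply/eqP; field.
  by rewrite gt_eqF.
Qed.
End concentration.

(** * Measurability and the space L2 *)

Section integral_extra.
Context {R : realType} {d} {T : measurableType d}.

(* The integral of a nonnegative function is defined as a supremum over the simple
   functions below it, which makes it monotone on arbitrary functions. *)
Lemma integral_le_ge0 (mu : {measure set T -> \bar R}) (f g : T -> \bar R) :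
  (forall x, 0 <= g x)%E -> (forall x, f x <= g x)%E ->
  (\int[mu]_x f x <= \int[mu]_x g x)%E.
Proof.
move=> g0 fg; rewrite integralE; apply: (@le_trans _ _ (\int[mu]_x f^\+ x)%E).
  by rewrite -[leRHS]sube0 leeB// integral_ge0.
rewrite !ge0_integralTE//; apply: le_ereal_sup => _ [h hf <-]; exists h => // x.
apply: le_trans (hf x) _; rewrite funeposE.
by rewrite ge_max fg g0.
Qed.

Context {d2} {T2 : measurableType d2}.

(** Tonelli's theorem for the positive and the negative part; the integral is their difference by
    definition, even where neither is finite. *)
Lemma measurable_parametric_integral (mu : {sigma_finite_measure set T2 -> \bar R})
    (f : T * T2 -> R) : measurable_fun setT f ->
  measurable_fun setT (fun x => (\int[mu]_y f (x, y))%R).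
Proof.
move=> mf; pose g p := (f p)%:E.
have mg : measurable_fun setT g by apply/measurable_EFinP.
apply: measurableT_comp => //.
rewrite (_ : (fun _ => _) =
    (fun x => \int[mu]_y (g^\+ (x, y)) - \int[mu]_y (g^\- (x, y)))%E).
  apply: emeasurable_funB.
  - apply: (measurable_fun_fubini_tonelli_F g^\+%E) => //.
    exact: measurable_funepos.
  - apply: (measurable_fun_fubini_tonelli_F g^\-%E) => //.
    exact: measurable_funeneg.
apply/funext => x; rewrite [LHS]integralE; congr (_ - _)%E.
  by apply: eq_integral => y _; rewrite /g !funeposE.
by apply: eq_integral => y _; rewrite /g !funenegE.
Qed.
End integral_extra.

Lemma continuous_rV_measurable {R : realType} d (g : 'rV[R]_d -> R) :
  continuous g -> measurable_fun setT g.
Proof.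
move=> /continuousP cg.
apply: (@measurability _ _ _ (measurableTypeR R) _ _ (@RGenOpens.G R)).
  exact: RGenOpens.measurableE.
move=> _ [_ [x [y ->]] <-]; rewrite setTI; apply: open_rV_measurable.
by apply: cg; exact: interval_open.
Qed.

Lemma continuous_lsubmx {R : realType} m n :
  continuous (lsubmx : 'rV[R]_(m + n) -> 'rV[R]_m).
Proof.
move=> v B /nbhs_ballP[e e0 eB]; apply/nbhs_ballP; exists e => // w [_ vw].
by apply: eB; split=> // i j; rewrite !mxE.
Qed.

Lemma continuous_rsubmx {R : realType} m n :
  continuous (rsubmx : 'rV[R]_(m + n) -> 'rV[R]_n).
Proof.
move=> v B /nbhs_ballP[e e0 eB]; apply/nbhs_ballP; exists e => // w [_ vw].
by apply: eB; split=> // i j; rewrite !mxE.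
Qed.

(** Pairs are concatenated into vectors of length d + d: continuity gives Borel measurability there,
    and concatenation is measurable for the product sigma-algebra because its coordinates are. *)
Lemma continuous_rV_rV_measurable {R : realType} d (K : 'rV[R]_d -> 'rV[R]_d -> R) :
  continuous (fun p : 'rV[R]_d * 'rV[R]_d => K p.1 p.2) ->
  measurable_fun setT (fun p : 'rV[R]_d * 'rV[R]_d => K p.1 p.2).
Proof.
move=> cK; pose g (v : 'rV[R]_(d + d)) := K (lsubmx v) (rsubmx v).
rewrite (_ : (fun _ => _) = g \o (fun p => row_mx p.1 p.2)); last first.
  by apply/funext => p; rewrite /g/= row_mxKl row_mxKr.
apply: measurableT_comp.
  apply: continuous_rV_measurable => v.
  apply: (@continuous_comp _ _ _ (fun v => (lsubmx v, rsubmx v)) (fun p => K p.1 p.2)).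
    exact: (cvg_pair (@continuous_lsubmx R d d v) (@continuous_rsubmx R d d v)).
  exact: cK.
apply/measurable_fun_rVP => i; case: (split_ordP i) => j ->.
  under eq_fun do rewrite row_mxEl.
  exact: (measurableT_comp (@measurable_coord R d j) measurable_fst).
under eq_fun do rewrite row_mxEr.
exact: (measurableT_comp (@measurable_coord R d j) measurable_snd).
Qed.

Section L2.
Context {R : realType} {d : nat}.
Local Notation mu := (lebesgue_rV R d).
Implicit Types g h : 'rV[R]_d -> R.

Lemma L2norm_sqE g : L2norm_sq g = (\int[mu]_x (g x ^+ 2)%:E)%E.
Proof.
have gE : (\int[mu]_x `|(EFin \o g) x| `^ 2 = \int[mu]_x (g x ^+ 2)%:E)%E.
  apply: eq_integral => x _; rewrite /= powR_mulrn//.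
  by rewrite real_normK ?num_real.
rewrite /L2norm_sq -gE -powR_Lnorm//.
have := Lnorm_ge0 mu 2%:E (EFin \o g).
case: ('N[mu]_2%:E[_]%E) => [r r0||//].
- by rewrite poweR_EFin powR_mulrn.
- by rewrite poweRyr.
Qed.

Lemma L2funP g : g \in L2fun <-> measurable_fun setT g /\ (L2norm_sq g < +oo)%E.
Proof.
have Nlt : (L2norm_sq g < +oo)%E <-> ('N[mu]_2%:E[EFin \o g] < +oo)%E.
  rewrite /L2norm_sq; have := Lnorm_ge0 mu 2%:E (EFin \o g).
  case: ('N[mu]_2%:E[_]%E) => [r r0||//].
  - by rewrite !ltry.
  - by rewrite ltxx.
rewrite /L2fun /Lfun; split => [/andP[/[!inE] mg Ng]|[mg Ng]].
  by split => //; exact/Nlt.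
by apply/andP; rewrite !inE; split => //; exact/Nlt.
Qed.

Lemma one_le2 : (1 <= 2%:E :> \bar R)%E. Proof. by rewrite lee_fin ler1n. Qed.

Definition L2space := LfunType mu one_le2.

Definition L2_of g (gL2 : g \in L2fun) : L2space := Lfun_Sub one_le2 gL2.

Definition dotL2 (u v : L2space) : R := L2dot u v.

Lemma L2dot_integrable g h : g \in L2fun -> h \in L2fun ->
  mu.-integrable setT (EFin \o (fun x => g x * h x)).
Proof. by move=> gL hL; apply/Lfun1_integrable; exact: Lfun2_mul_Lfun1. Qed.

Lemma L2space_in (u : L2space) : (u : 'rV[R]_d -> R) \in L2fun.
Proof. exact: LfunP. Qed.
Hint Resolve L2space_in : core.

Lemma L2norm_sq_dot g : g \in L2fun -> L2norm_sq g = (L2dot g g)%:E.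
Proof.
move=> gL; rewrite L2norm_sqE /L2dot /Rintegral fineK; last first.
  by apply: integrable_fin_num => //; exact: L2dot_integrable.
by apply: eq_integral => x _; rewrite expr2.
Qed.

Lemma dotL2P : semi_inner_product dotL2.
Proof.
split.
- by move=> u v; apply: eq_Rintegral => x _; rewrite mulrC.
- move=> u v w; rewrite /dotL2 /L2dot -RintegralD//; try exact: L2dot_integrable.
  by apply: eq_Rintegral => x _; rewrite mulrDl.
- move=> c u v; rewrite /dotL2 /L2dot -RintegralZl//; last exact: L2dot_integrable.
  by apply: eq_Rintegral => x _; rewrite mulrA.
- by move=> u; apply: Rintegral_ge0 => x _; rewrite -expr2 sqr_ge0.
Qed.

End L2.

(** * Weighted kernels *)

Section kernel.
Context {R : realType} {d : nat}.
Local Notation mu := (lebesgue_rV R d).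
Local Notation T := ('rV[R]_d * measurableTypeR R)%type.
Variable law : probability ('rV[R]_d * measurableTypeR R)%type R.
Variable K : 'rV[R]_d -> 'rV[R]_d -> R.
Hypothesis K_kernel : density_kernel K.
Variable kap : R.
Hypothesis K_le : forall x', (L2norm_sq (K x') <= (kap ^+ 2)%:E)%E.

Implicit Types (l : R -> R) (psi : 'rV[R]_d -> R).

Definition weighted l (z : T) (x : 'rV[R]_d) : R := K z.1 x * l z.2.

Lemma measurable_kernel : measurable_fun setT (fun p : 'rV[R]_d * 'rV[R]_d => K p.1 p.2).
Proof. by apply: continuous_rV_rV_measurable; case: K_kernel. Qed.

Lemma kernel_L2 x' : K x' \in L2fun.
Proof.
apply/L2funP; split; last by apply: le_lt_trans (K_le x') _; rewrite ltry.
rewrite (_ : K x' = (fun p : 'rV[R]_d * 'rV[R]_d => K p.1 p.2) \o (pair x'))//.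
apply: measurableT_comp; first exact: measurable_kernel.
exact: measurable_pair1.
Qed.

Lemma measurable_weighted l : measurable_fun setT l ->
  measurable_fun setT (fun p : T * 'rV[R]_d => weighted l p.1 p.2).
Proof.
move=> ml; apply: measurable_funM.
  rewrite (_ : (fun _ => _) = (fun p : 'rV[R]_d * 'rV[R]_d => K p.1 p.2) \o
    (fun p : T * 'rV[R]_d => (p.1.1, p.2)))//.
  apply: measurableT_comp; first exact: measurable_kernel.
  apply: measurable_fun_pair => //.
  exact: (measurableT_comp measurable_fst measurable_fst).
apply: (measurableT_comp ml).
exact: (measurableT_comp measurable_snd measurable_fst).
Qed.

Lemma weighted_L2 l z : weighted l z \in L2fun.
Proof.
have /L2funP[mK KL] := kernel_L2 z.1; apply/L2funP; split.
  exact: measurable_funM.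
rewrite L2norm_sqE; under eq_integral do rewrite /weighted exprMn EFinM muleC.
rewrite ge0_integralZl_EFin ?sqr_ge0//; last 2 first.
- by move=> x _; rewrite lee_fin sqr_ge0.
- by apply/measurable_EFinP; exact: measurable_funX.
by rewrite -L2norm_sqE lte_mul_pinfty// lee_fin sqr_ge0.
Qed.

Lemma L2dot_weightedr l psi z : psi \in L2fun ->
  L2dot psi (weighted l z) = l z.2 * L2dot (K z.1) psi.
Proof.
move=> psiL; rewrite /L2dot -RintegralZl//.
  by apply: eq_Rintegral => x _; rewrite /weighted; ring.
by apply: L2dot_integrable => //; exact: kernel_L2.
Qed.

Lemma L2dot_weighted l z :
  L2dot (weighted l z) (weighted l z) = l z.2 ^+ 2 * L2dot (K z.1) (K z.1).
Proof.
rewrite /L2dot -RintegralZl//.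
  by apply: eq_Rintegral => x _; rewrite /weighted; ring.
by apply: L2dot_integrable; exact: kernel_L2.
Qed.

Lemma L2dot_kernel_le x' : 0 <= L2dot (K x') (K x') <= kap ^+ 2.
Proof.
apply/andP; split; first by apply: Rintegral_ge0 => x _; rewrite -expr2 sqr_ge0.
by rewrite -lee_fin -L2norm_sq_dot ?K_le// kernel_L2.
Qed.

Lemma L2dot_le psi h (M N : R) : psi \in L2fun -> h \in L2fun -> 0 <= M -> 0 <= N ->
  L2dot psi psi <= M ^+ 2 -> L2dot h h <= N ^+ 2 -> `|L2dot psi h| <= M * N.
Proof.
move=> psiL hL M0 N0 psiM hN.
exact: (@dot_le _ _ dotL2 dotL2P (L2_of psiL) (L2_of hL)).
Qed.

Lemma measurable_L2dot_weighted l psi : measurable_fun setT l ->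
  measurable_fun setT psi ->
  measurable_fun setT (fun z => L2dot psi (weighted l z)).
Proof.
move=> ml mpsi.
apply: (measurable_parametric_integral mu
  (f := fun p : T * 'rV[R]_d => psi p.2 * weighted l p.1 p.2)).
apply: measurable_funM; last exact: measurable_weighted.
exact: (measurableT_comp mpsi measurable_snd).
Qed.

Lemma measurable_gram_weighted l : measurable_fun setT l ->
  measurable_fun setT (fun p : T * T => L2dot (weighted l p.1) (weighted l p.2)).
Proof.
move=> ml.
apply: (measurable_parametric_integral mu
  (f := fun p : (T * T) * 'rV[R]_d => weighted l p.1.1 p.2 * weighted l p.1.2 p.2)).
apply: measurable_funM.
- rewrite (_ : (fun _ => _) = (fun p : T * 'rV[R]_d => weighted l p.1 p.2) \o
    (fun p : (T * T) * 'rV[R]_d => (p.1.1, p.2)))//.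
  apply: measurableT_comp; first exact: measurable_weighted.
  apply: measurable_fun_pair => //.
  exact: (measurableT_comp measurable_fst measurable_fst).
- rewrite (_ : (fun _ => _) = (fun p : T * 'rV[R]_d => weighted l p.1 p.2) \o
    (fun p : (T * T) * 'rV[R]_d => (p.1.2, p.2)))//.
  apply: measurableT_comp; first exact: measurable_weighted.
  apply: measurable_fun_pair => //.
  exact: (measurableT_comp measurable_snd measurable_fst).
Qed.

Lemma measurable_mean_estimator l : measurable_fun setT l ->
  measurable_fun setT (mean_estimator law l K).
Proof.
move=> ml; rewrite (_ : mean_estimator law l K =
    (fun x => \int[law]_w weighted l w x)%R); last first.
  by apply/funext => x; rewrite /mean_estimator unlock.
apply: (measurable_parametric_integral law
  (f := fun p : 'rV[R]_d * T => weighted l p.2 p.1)).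
rewrite (_ : (fun _ => _) = (fun p : T * 'rV[R]_d => weighted l p.1 p.2) \o
  (fun p : 'rV[R]_d * T => (p.2, p.1)))//.
apply: measurableT_comp; first exact: measurable_weighted.
exact: measurable_fun_pair.
Qed.

Hypothesis kap_ge0 : 0 <= kap.

Lemma L2dot_weighted_le l psi M z : psi \in L2fun -> 0 <= M ->
  L2dot psi psi <= M ^+ 2 -> `|L2dot psi (weighted l z)| <= M * kap * `|l z.2|.
Proof.
move=> psiL M0 psiM; rewrite L2dot_weightedr// normrM mulrC ler_wpM2r// mulrC.
have /andP[_ h] := L2dot_kernel_le z.1.
by apply: L2dot_le => //; exact: kernel_L2.
Qed.

Section mean.
Variable l : R -> R.
Hypothesis ml : measurable_fun setT l.
Hypothesis il : law.-integrable setT (fun w => (l w.2)%:E).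

Let ml2 : measurable_fun setT (fun w : T => l w.2).
Proof. exact: (measurableT_comp ml measurable_snd). Qed.

Lemma integrable_L2dot_weighted psi : psi \in L2fun ->
  law.-integrable setT (EFin \o (fun z => L2dot psi (weighted l z))).
Proof.
move=> psiL; have /L2funP[mpsi _] := psiL.
pose M := Num.sqrt (L2dot psi psi).
have M2 : L2dot psi psi <= M ^+ 2.
  by rewrite sqr_sqrtr// Rintegral_ge0// => x _; rewrite -expr2 sqr_ge0.
apply: (@le_integrable _ _ _ law _ _ _ (EFin \o (fun w => M * kap * l w.2))) => //.
- by apply/measurable_EFinP; exact: measurable_L2dot_weighted.
- move=> z _ /=; rewrite lee_fin normrM [`|M * kap|]ger0_norm ?mulr_ge0 ?sqrtr_ge0//.
  by apply: L2dot_weighted_le => //; exact: sqrtr_ge0.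
- exact: (integrableZl measurableT _ il).
Qed.

(** Fubini's theorem. Absolute integrability follows from Cauchy-Schwarz in x, applied to the
    absolute values, and from the integrability of the weight. *)
Lemma integral_L2dot_weighted psi : psi \in L2fun ->
  \int[law]_z L2dot psi (weighted l z) = L2dot psi (mean_estimator law l K).
Proof.
move=> psiL; have /L2funP[mpsi _] := psiL.
pose F (p : T * 'rV[R]_d) := (psi p.2 * weighted l p.1 p.2)%:E.
have mF : measurable_fun setT F.
  apply/measurable_EFinP; apply: measurable_funM; last exact: measurable_weighted.
  exact: (measurableT_comp mpsi measurable_snd).
pose M := Num.sqrt (L2dot psi psi).
have apsiL : (fun x => `|psi x|) \in L2fun.
  apply/L2funP; split; first exact: measurableT_comp.
  have /L2funP[_] := psiL; rewrite !L2norm_sqE.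
  by under [X in (X < _)%E -> _]eq_integral do rewrite -[psi _ ^+ 2]real_normK ?num_real//.
have aM2 : L2dot (fun x => `|psi x|) (fun x => `|psi x|) <= M ^+ 2.
  rewrite sqr_sqrtr; last by rewrite Rintegral_ge0// => x _; rewrite -expr2 sqr_ge0.
  rewrite le_eqVlt; apply/orP; left; apply/eqP; apply: eq_Rintegral => x _.
  by rewrite -!expr2 real_normK ?num_real.
have iF : (law \x mu)%E.-integrable setT F.
  apply/integrable12ltyP => //.
  apply: (@le_lt_trans _ _ (\int[law]_w (M * kap * `|l w.2|)%:E)%E).
    apply: integral_le_ge0 => w; first by rewrite lee_fin !mulr_ge0 ?sqrtr_ge0.
    have awL : (fun x => `|weighted l w x|) \in L2fun.
      apply/L2funP; split.
        by apply: measurableT_comp => //; have /L2funP[] := weighted_L2 l w.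
      have /L2funP[_] := weighted_L2 l w; rewrite !L2norm_sqE.
      by under [X in (X < _)%E -> _]eq_integral do
        rewrite -[weighted _ _ _ ^+ 2]real_normK ?num_real//.
    have -> : (\int[mu]_y `|F (w, y)| =
        (L2dot (fun x => `|psi x|) (fun x => `|weighted l w x|))%:E)%E.
      rewrite /L2dot /Rintegral fineK; last first.
        by apply: integrable_fin_num => //; exact: L2dot_integrable.
      by apply: eq_integral => x _; rewrite /F/= normrM.
    rewrite lee_fin (le_trans (ler_norm _))// -mulrA.
    apply: L2dot_le => //; [exact: sqrtr_ge0|exact: mulr_ge0|].
    apply: (@le_trans _ _ (L2dot (weighted l w) (weighted l w))).
      rewrite le_eqVlt; apply/orP; left; apply/eqP; apply: eq_Rintegral => x _.
      by rewrite -!expr2 real_normK ?num_real.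
    rewrite L2dot_weighted exprMn mulrC real_normK ?num_real// ler_wpM2r ?sqr_ge0//.
    by have /andP[] := L2dot_kernel_le w.1.
  have /integrableP[_] := integrableZl measurableT (M * kap) il.
  congr (_ < _)%E; apply: eq_integral => w _.
  by rewrite -EFinM/= normrM [`|M * kap|]ger0_norm ?mulr_ge0 ?sqrtr_ge0.
rewrite /Rintegral /L2dot /Rintegral; congr fine.
transitivity (\int[law]_w \int[mu]_x F (w, x))%E.
  apply: eq_integral => w _; rewrite /L2dot /Rintegral fineK//.
  apply: integrable_fin_num => //; apply: L2dot_integrable => //.
  exact: weighted_L2.
rewrite (Fubini iF).
apply: ae_eq_integral => //.
- exact: (measurable_fubini_G iF).
- apply/measurable_EFinP; apply: measurable_funM => //.
  exact: measurable_mean_estimator.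
(* [mean_estimator] has a default value where the expectation is not finite. For almost every x with
   psi x nonzero, Fubini makes the expectation finite; where psi x = 0 both sides vanish, whatever
   the default. *)
have := ae_integrable2 iF; apply: filterS => x /= ix _.
rewrite /F/=; have [psi0|psi0] := eqVneq (psi x) 0.
  rewrite psi0 [in RHS]mul0r; apply: integral0_eq => w _.
  by rewrite mul0r.
have iw : law.-integrable setT (fun w => (weighted l w x)%:E).
  have := integrableZl measurableT (psi x)^-1 ix; congr (_.-integrable _ _).
  by apply/funext => w; rewrite -EFinM /F/= mulrA mulVf ?mul1r.
under eq_integral do rewrite EFinM.
rewrite integralZl// EFinM; congr (_ * _)%E.
rewrite /mean_estimator unlock fineK//.
exact: integrable_fin_num.
Qed.

End mean.
End kernel.

(** * Deviation for one kernel *)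

Section L2space_eval.
Context {R : realType} {d : nat}.
Implicit Types u v : @L2space R d.

Lemma L2spaceB u v x : (u - v) x = u x - v x. Proof. by []. Qed.
Lemma L2spaceZ c u x : (c *: u) x = c * u x. Proof. by []. Qed.
Lemma L2space_sum I (r : seq I) (F : I -> @L2space R d) x :
  (\sum_(i <- r) F i) x = \sum_(i <- r) F i x.
Proof. by apply: (big_morph (fun u : @L2space R d => u x)). Qed.
End L2space_eval.

(** Large values are sent to 0 and not clipped, so that [l] and its truncation differ by [l] itself
    where it exceeds the level. *)
Definition truncate {R : realType} (L : R) (l : R -> R) (y : R) :=
  if `|l y| <= L then l y else 0.

Lemma truncate_le {R : realType} (L : R) l y : 0 <= L -> `|truncate L l y| <= L.
Proof. by rewrite /truncate; case: ifP => // _ L0; rewrite normr0. Qed.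

Lemma measurable_truncate {R : realType} (L : R) l :
  measurable_fun setT l -> measurable_fun setT (truncate L l).
Proof.
move=> ml; apply: measurable_fun_ifT => //.
by apply: measurable_fun_ler => //; exact: measurableT_comp.
Qed.

Section kernel_deviation.
Context {R : realType} {d : nat}.
Local Notation mu := (lebesgue_rV R d).
Local Notation T := ('rV[R]_d * measurableTypeR R)%type.
Variable law : probability ('rV[R]_d * measurableTypeR R)%type R.
Variables (K : 'rV[R]_d -> 'rV[R]_d -> R) (l : R -> R) (s : 'rV[R]_d -> R).
Variables (m : R) (n : nat).
Hypothesis n_gt0 : (0 < n)%N.
Hypothesis m_gt0 : 0 < m.
Hypothesis K_kernel : density_kernel K.
Hypothesis cond1 : forall x', (L2norm_sq (K x') <= (m * n%:R)%:E)%E.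
Hypothesis cond2 : (L2norm_sq (mean_estimator law l K) <= m%:E)%E.
Hypothesis cond4 : forall psi, psi \in L2fun ->
  ('E_law[(fun w => (L2dot (K w.1) psi) ^+ 2)%R] <= m%:E * L2norm_sq psi)%E.
Hypothesis ml : measurable_fun setT l.
Hypothesis il : law.-integrable setT (fun w => (l w.2)%:E).
Hypothesis il2 : law.-integrable setT (fun w => (l w.2 ^+ 2)%:E).
Hypothesis sL : s \in L2fun.

Let kap := Num.sqrt (m * n%:R).

Let n0 : 0 < n%:R :> R. Proof. by rewrite ltr0n. Qed.
Let n1 : 1 <= n%:R :> R. Proof. by rewrite ler1n. Qed.

Let kap2 : kap ^+ 2 = m * n%:R.
Proof. by rewrite sqr_sqrtr// mulr_ge0// ltW. Qed.

Let kap_gt0 : 0 < kap. Proof. by rewrite sqrtr_gt0 mulr_gt0. Qed.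

Let K_le x' : (L2norm_sq (K x') <= (kap ^+ 2)%:E)%E.
Proof. by rewrite kap2. Qed.

Let wL l' w : weighted K l' w \in L2fun.
Proof. exact: (weighted_L2 K_kernel K_le). Qed.

Lemma mean_estimator_L2 : mean_estimator law l K \in L2fun.
Proof.
apply/L2funP; split; first exact: measurable_mean_estimator.
by apply: le_lt_trans cond2 _; rewrite ltry.
Qed.

Let a := L2_of mean_estimator_L2.
Let sigma := \int[law]_w L2dot (weighted K l w) (weighted K l w).

Let measurable_sqnorm l' : measurable_fun setT l' ->
  measurable_fun setT (fun w => L2dot (weighted K l' w) (weighted K l' w)).
Proof.
move=> ml'; rewrite (_ : (fun _ => _) =
  (fun p : T * T => L2dot (weighted K l' p.1) (weighted K l' p.2)) \o
  (fun w => (w, w)))//.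
apply: measurableT_comp; first exact: measurable_gram_weighted.
exact: measurable_fun_pair.
Qed.

Let sqnorm_ge0 (g : 'rV[R]_d -> R) : 0 <= L2dot g g.
Proof. by apply: Rintegral_ge0 => x _; rewrite -expr2 sqr_ge0. Qed.

Let sqnorm_weighted_le l' w :
  L2dot (weighted K l' w) (weighted K l' w) <= m * n%:R * l' w.2 ^+ 2.
Proof.
rewrite (L2dot_weighted K_kernel K_le) mulrC ler_wpM2r ?sqr_ge0// -kap2.
by have /andP[] := L2dot_kernel_le K_kernel K_le w.1.
Qed.

Let isig : law.-integrable setT
  (EFin \o (fun w => L2dot (weighted K l w) (weighted K l w))).
Proof.
apply: (@le_integrable _ _ _ law _ _ _
    (EFin \o (fun w => m * n%:R * (l w.2 ^+ 2)))) => //.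
- by apply/measurable_EFinP; exact: measurable_sqnorm.
- move=> w _ /=; rewrite lee_fin ger0_norm// ger0_norm//.
  by rewrite mulr_ge0 ?sqr_ge0// mulr_ge0 ?(ltW m_gt0).
- exact: (integrableZl measurableT _ il2).
Qed.

Lemma mean_L2norm_sqE : mean_L2norm_sq law l K = sigma%:E.
Proof.
rewrite /mean_L2norm_sq /sigma /Rintegral fineK; last exact: integrable_fin_num.
apply: eq_integral => w _.
by rewrite -L2norm_sq_dot//; exact: wL.
Qed.

Lemma sigma_bounds : 0 <= sigma <= m * n%:R * \int[law]_w (l w.2 ^+ 2).
Proof.
rewrite Rintegral_ge0//= -RintegralZl//; apply: le_Rintegral => //.
exact: (integrableZl measurableT _ il2).
Qed.

Definition kernel_risk : R := oracle_risk n dotL2 a (L2_of sL) sigma.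

Lemma kernel_riskE :
  (L2norm_sq (mean_estimator law l K \- s) + mean_L2norm_sq law l K * (n%:R^-1)%:E
   = kernel_risk%:E)%E.
Proof.
rewrite mean_L2norm_sqE /kernel_risk /oracle_risk EFinD; congr (_ + _)%E.
exact: (L2norm_sq_dot (L2space_in (a - L2_of sL))).
Qed.

Lemma sqnorm_mean_le : dotL2 a a <= m.
Proof. by rewrite -lee_fin -[leLHS]L2norm_sq_dot//; exact: L2space_in. Qed.

Lemma sqnormB_le (u v : @L2space R d) :
  dotL2 (u - v) (u - v) <= 2 * dotL2 u u + 2 * dotL2 v v.
Proof.
have [_ _ _ h] := @dotL2P R d; have := h (u + v).
by rewrite (dot_sqrD dotL2P) (dot_sqrB dotL2P); lra.
Qed.

Lemma kernel_risk_bounds : 0 <= kernel_risk <=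
  2 * m + 2 * L2dot s s + m * \int[law]_w (l w.2 ^+ 2).
Proof.
have /andP[s0 s1] := sigma_bounds; rewrite /kernel_risk /oracle_risk.
apply/andP; split; first by rewrite addr_ge0 ?sqnorm_ge0// divr_ge0.
apply: lerD; last by rewrite ler_pdivrMr// mulrAC.
apply: le_trans (sqnormB_le _ _) _.
by rewrite lerD2r ler_pM2l// sqnorm_mean_le.
Qed.

(** Each inner product in the double sum is at most the half sum of the two squared norms. The bound
    holds for every sample; it will serve on the exceptional event. *)
Lemma estimator_L2 (z : 'I_n -> T) :
  exists2 e : R, L2norm_sq (estimator l K z \- s) = e%:E &
    0 <= e <= 2 * L2dot s s + 2 * m * \sum_(i < n) l (z i).2 ^+ 2.
Proof.
pose phi w := L2_of (wL l w).
pose h : @L2space R d := empirical_mean phi z.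
have hE : estimator l K z = h.
  apply/funext => x; rewrite /estimator /h /empirical_mean L2spaceZ.
  by rewrite L2space_sum.
exists (dotL2 (h - L2_of sL) (h - L2_of sL)).
  by rewrite hE; exact: (L2norm_sq_dot (L2space_in (h - L2_of sL))).
rewrite sqnorm_ge0 /= (le_trans (sqnormB_le _ _))// addrC lerD2l.
rewrite -mulrA ler_pM2l// /h /empirical_mean.
have [_ _ Zl _] := @dotL2P R d.
rewrite Zl (dotZr dotL2P) (dot_suml dotL2P) mulrA -expr2.
rewrite exprVn mulrC ler_pdivrMr ?exprn_gt0//.
have hij i j : dotL2 (phi (z i)) (phi (z j)) <=
    m * n%:R * (l (z i).2 ^+ 2 + l (z j).2 ^+ 2) / 2.
  have := sqnorm_ge0 (phi (z i) - phi (z j)).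
  rewrite -/(dotL2 (phi (z i) - phi (z j)) _) (dot_sqrB dotL2P).
  have := sqnorm_weighted_le l (z i); have := sqnorm_weighted_le l (z j).
  rewrite -/(dotL2 (phi (z i)) (phi (z i))) -/(dotL2 (phi (z j)) (phi (z j))).
  by lra.
apply: (@le_trans _ _ (\sum_(i < n) \sum_(j < n)
    (m * n%:R * (l (z i).2 ^+ 2 + l (z j).2 ^+ 2) / 2))).
  apply: ler_sum => i _; case: (@dotL2P R d) => C _ _ _.
  rewrite C (dot_suml dotL2P); apply: ler_sum => j _.
  by rewrite C.
pose N := \sum_(j < n) l (z j).2 ^+ 2.
have sumE (b c : R) : \sum_(j < n) (b + c * l (z j).2 ^+ 2) = n%:R * b + c * N.
  by rewrite big_split/= sumr_const card_ord -mulr_sumr mulr_natl.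
have E i : \sum_(j < n) (m * n%:R * (l (z i).2 ^+ 2 + l (z j).2 ^+ 2) / 2) =
    m * n%:R / 2 * N + n%:R * (m * n%:R / 2) * l (z i).2 ^+ 2.
  rewrite (eq_bigr (fun j : 'I_n => m * n%:R * l (z i).2 ^+ 2 / 2 +
    m * n%:R / 2 * l (z j).2 ^+ 2)); last by move=> j _; ring.
  by rewrite sumE; ring.
rewrite (eq_bigr _ (fun i _ => E i)) sumE -/N le_eqVlt; apply/orP; left; apply/eqP.
by field.
Qed.

(** * Truncated weighted kernels meet the hypotheses of the concentration theorem *)

Section tail.
Variable L : R.
Hypothesis L_ge1 : 1 <= L.
Let tl := truncate L l.
Hypothesis excess1 : \int[law]_w `|l w.2 - tl w.2| <= n%:R^-1.
Hypothesis excess2 : \int[law]_w (l w.2 ^+ 2 - tl w.2 ^+ 2) <= n%:R^-1.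
Variables (dO : measure_display) (Omega : measurableType dO) (P : probability Omega R)
  (Z : 'I_n -> {mfun Omega >-> T}).
Hypothesis iidZ : iid_sample P law Z.

Let L0 : 0 < L. Proof. exact: lt_le_trans ltr01 L_ge1. Qed.
Let mtl : measurable_fun setT tl. Proof. exact: measurable_truncate. Qed.
Let B := kap * L.
Let B0 : 0 < B. Proof. by rewrite mulr_gt0. Qed.
Let phi w := L2_of (wL tl w).

Let B2 : B ^+ 2 = m * n%:R * L ^+ 2. Proof. by rewrite exprMn kap2. Qed.
Let B2n : B ^+ 2 / n%:R = m * L ^+ 2.
Proof. by rewrite B2 mulrAC mulfK ?gt_eqF. Qed.
Let L2_ge1 : 1 <= L ^+ 2. Proof. by rewrite exprn_ege1. Qed.
Let tl_sqr w : tl w ^+ 2 <= L ^+ 2.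
Proof.
rewrite -[tl w ^+ 2]real_normK ?num_real// lerXn2r ?nnegrE ?(ltW L0)//.
by apply: truncate_le; exact: ltW.
Qed.

Let phi_le w : dotL2 (phi w) (phi w) <= B ^+ 2.
Proof.
rewrite B2; apply: le_trans (sqnorm_weighted_le tl w) _.
by rewrite ler_pM2l ?mulr_gt0// tl_sqr.
Qed.

Let a_le : n%:R * dotL2 a a <= B ^+ 2.
Proof.
rewrite B2 [m * _]mulrC -mulrA ler_pM2l//.
by apply: le_trans sqnorm_mean_le _; rewrite ler_peMr// ltW.
Qed.

Let mtl2 : measurable_fun setT (fun w : T => tl w.2).
Proof. exact: (measurableT_comp mtl measurable_snd). Qed.

Let itl : law.-integrable setT (fun w => (tl w.2)%:E).
Proof.
by apply: (@bounded_integrable _ _ _ _ _ L) => // w; apply: truncate_le; exact: ltW.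
Qed.

(** Condition (4) applied to [u], once the squared weight is bounded by L^2. *)
Let variance_le (u : @L2space R d) :
  \int[law]_w (dotL2 u (phi w) ^+ 2) <= B ^+ 2 / n%:R * dotL2 u u.
Proof.
have uL := L2space_in u; have /L2funP[mu_ _] := uL.
have mK : measurable_fun setT (fun w : T => L2dot u (weighted K (cst 1) w)).
  exact: (measurable_L2dot_weighted K_kernel).
have KE w : L2dot u (weighted K (cst 1) w) = L2dot (K w.1) u.
  rewrite (L2dot_weightedr K_kernel K_le)//= mul1r.
  by apply: eq_Rintegral => x _; rewrite mulrC.
rewrite -lee_fin /Rintegral fineK; last first.
  apply: integrable_fin_num => //.
  pose M := Num.sqrt (dotL2 u u).
  have uM : dotL2 u u <= M ^+ 2 by rewrite sqr_sqrtr// sqnorm_ge0.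
  apply: (@bounded_integrable _ _ _ _ _ ((M * B) ^+ 2)).
    apply: measurable_funX; exact: (measurable_L2dot_weighted K_kernel).
  move=> w; rewrite normrX lerXn2r ?nnegrE ?mulr_ge0 ?sqrtr_ge0 ?(ltW L0)//.
  by apply: (dot_le dotL2P) => //; [exact: sqrtr_ge0|exact: ltW].
have mKu : measurable_fun setT (fun w : T => L2dot (K w.1) u).
  by under eq_fun do rewrite -KE.
apply: (@le_trans _ _ (\int[law]_w ((L ^+ 2)%:E * (L2dot (K w.1) u ^+ 2)%:E)%E)%E).
  apply: integral_le_ge0 => w.
    by rewrite -EFinM lee_fin mulr_ge0 ?sqr_ge0.
  rewrite -EFinM lee_fin /dotL2 (L2dot_weightedr K_kernel K_le)// exprMn.
  by rewrite ler_wpM2r ?sqr_ge0.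
rewrite ge0_integralZl_EFin ?sqr_ge0//; last 2 first.
- by move=> w _; rewrite lee_fin sqr_ge0.
- by apply/measurable_EFinP; exact: measurable_funX.
have := cond4 uL; rewrite unlock => h.
rewrite B2n [m * _]mulrC -mulrA (EFinM (L ^+ 2)) lee_pmul2l// ?lte_fin ?exprn_gt0//.
by apply: le_trans h _; rewrite EFinM L2norm_sq_dot.
Qed.

(** By Fubini, the inner product with [a] is the mean of the untruncated one. The difference
    involves the weight l - tl only, whose mean absolute value is at most 1 / n by [excess1]. *)
Let bias_le (u : @L2space R d) M : 0 <= M -> dotL2 u u <= M ^+ 2 ->
  `|\int[law]_w dotL2 u (phi w - a)| <= B / n%:R * M.
Proof.
move=> M0 uM; have uL := L2space_in u.
have i1 := integrable_L2dot_weighted K_kernel K_le (ltW kap_gt0) mtl itl uL.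
have i2 := integrable_L2dot_weighted K_kernel K_le (ltW kap_gt0) ml il uL.
have -> : \int[law]_w dotL2 u (phi w - a) =
    \int[law]_w (L2dot u (weighted K tl w) - L2dot u (weighted K l w)).
  rewrite RintegralB// (integral_L2dot_weighted K_kernel K_le (ltW kap_gt0) ml il uL).
  under eq_Rintegral do rewrite (dotDr dotL2P) (dotNr dotL2P).
  rewrite RintegralB//; last first.
    apply: (@bounded_integrable _ _ _ _ _ `|dotL2 u a|) => //.
  congr (_ - _); rewrite Rintegral_cst//= probability_setT/= mulr1//.
apply: le_trans (le_normr_Rintegral measurableT _) _.
  exact: (integrableB measurableT i1 i2).
have iex : law.-integrable setT (EFin \o (fun w => `|l w.2 - tl w.2|)).
  apply: integrable_norm => //; exact: (integrableB measurableT il itl).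
apply: (@le_trans _ _ (\int[law]_w (M * kap * `|l w.2 - tl w.2|))).
  apply: le_Rintegral => //.
  - apply: integrable_norm => //; exact: (integrableB measurableT i1 i2).
  - exact: (integrableZl measurableT _ iex).
  move=> w _; rewrite -opprB normrN.
  have -> : L2dot u (weighted K l w) - L2dot u (weighted K tl w) =
      L2dot u (weighted K (fun y => l y - tl y) w).
    rewrite !(L2dot_weightedr K_kernel K_le)//; ring.
  exact: (L2dot_weighted_le K_kernel K_le (ltW kap_gt0) _ _ uL M0 uM).
rewrite RintegralZl//.
apply: (@le_trans _ _ (M * kap * n%:R^-1)).
  by rewrite ler_wpM2l// mulr_ge0// ltW.
rewrite (_ : B / n%:R * M = M * kap * n%:R^-1 * L); last by rewrite /B; ring.
by rewrite ler_peMr// mulr_ge0 ?invr_ge0 ?(ltW n0)// mulr_ge0// ltW.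
Qed.

Let isig_tl : law.-integrable setT
  (EFin \o (fun w => L2dot (weighted K tl w) (weighted K tl w))).
Proof.
apply: (@bounded_integrable _ _ _ _ _ (B ^+ 2)); first exact: measurable_sqnorm.
by move=> w; rewrite ger0_norm ?sqnorm_ge0//; exact: phi_le.
Qed.

Let tl_le y : tl y ^+ 2 <= l y ^+ 2.
Proof. by rewrite /tl /truncate; case: ifP => // _; rewrite expr0n sqr_ge0. Qed.

Let sigma_ge : \int[law]_w dotL2 (phi w) (phi w) <= sigma.
Proof.
apply: le_Rintegral => // w _; rewrite /dotL2 !(L2dot_weighted K_kernel K_le).
by rewrite ler_wpM2r// sqnorm_ge0.
Qed.

(** The squared norms differ by at most m n (l^2 - tl^2), of mean at most m by [excess2], and m <= m
    L^2 = B^2 / n. *)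
Let sigma_le : sigma <= \int[law]_w dotL2 (phi w) (phi w) + B ^+ 2 / n%:R.
Proof.
rewrite -lerBlDl -RintegralB//.
have itl2 : law.-integrable setT (EFin \o (fun w => tl w.2 ^+ 2)).
  apply: (@bounded_integrable _ _ _ _ _ (L ^+ 2)) => [|w].
    exact: measurable_funX.
  by rewrite ger0_norm ?sqr_ge0.
have iex : law.-integrable setT (EFin \o (fun w => l w.2 ^+ 2 - tl w.2 ^+ 2)).
  exact: (integrableB measurableT il2 itl2).
apply: (@le_trans _ _ (\int[law]_w (m * n%:R * (l w.2 ^+ 2 - tl w.2 ^+ 2)))).
  apply: le_Rintegral => //.
  - exact: (integrableB measurableT isig isig_tl).
  - exact: (integrableZl measurableT _ iex).
  move=> w _; rewrite /dotL2 !(L2dot_weighted K_kernel K_le) -mulrBl mulrC.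
  rewrite ler_wpM2r ?subr_ge0// -kap2.
  by have /andP[] := L2dot_kernel_le K_kernel K_le w.1.
rewrite RintegralZl// B2n.
apply: (@le_trans _ _ (m * n%:R * n%:R^-1)).
  by rewrite ler_wpM2l// mulr_ge0// ltW.
by rewrite mulfK ?gt_eqF// ler_peMr// ltW.
Qed.

Lemma kernel_deviation (x theta : R) : 3 <= x -> 0 < theta < 1 ->
  exists2 G : set Omega,
    measurable G /\ (P (~` G) <= ((n + 9)%:R * expR (- x))%:E)%E &
    forall w e, G w -> (forall i, `|l (Z i w).2| <= L) ->
      L2norm_sq (estimator l K (fun i => Z i w) \- s) = e%:E ->
      `|e - kernel_risk| <= theta * kernel_risk
        + 400 * m * (L * x) ^+ 2 / (theta * n%:R).
Proof.
move=> x3 th01.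
have m1 (u : @L2space R d) : measurable_fun setT (fun z => dotL2 u (phi z)).
  have /L2funP[mu_ _] := L2space_in u.
  exact: (measurable_L2dot_weighted K_kernel).
have m2 : measurable_fun setT (fun p : T * T => dotL2 (phi p.1) (phi p.2)).
  exact: (measurable_gram_weighted K_kernel).
have [G mG GP] := @sqnorm_error_tail _ _ _ _ _ P law n Z n_gt0 iidZ (0, 0)
  _ _ dotL2P phi a (L2_of sL) B sigma B0 m1 m2 phi_le a_le variance_le bias_le
  sigma_ge sigma_le x theta x3 th01.
exists G => // w e Gw lL eE.
have := GP w Gw.
(* When no weight exceeds [L], the estimator and its truncated version coincide. *)
have -> : dotL2 (empirical_mean phi (fun j => Z j w) - L2_of sL)
    (empirical_mean phi (fun j => Z j w) - L2_of sL) = e.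
  apply: EFin_inj; rewrite -eE.
  rewrite -[LHS](L2norm_sq_dot (L2space_in (empirical_mean phi (fun j => Z j w) - L2_of sL))).
  congr L2norm_sq; apply/funext => y; rewrite L2spaceB; congr (_ - _).
  rewrite /empirical_mean L2spaceZ L2space_sum /estimator; congr (_ * _).
  by apply: eq_bigr => i _; rewrite /= /weighted /tl /truncate lL.
move=> /le_trans; apply; rewrite lerD2l exprMn B2.
rewrite le_eqVlt; apply/orP; left; apply/eqP; field.
by have /andP[th0 _] := th01; rewrite !gt_eqF.
Qed.
End tail.

End kernel_deviation.

(** * Exponential moments and truncation *)

Section exponential_moment.
Context {R : realType} {d} {T : measurableType d} (law : probability T R).
Variables (f : T -> R) (alpha : R).
Hypothesis mf : measurable_fun setT f.
Hypothesis alpha_gt0 : 0 < alpha.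
Hypothesis exp_moment : ('E_law[(fun w => expR (alpha * `|f w|))%R] < +oo)%E.

Let W w := expR (alpha * `|f w|).

Let mW : measurable_fun setT W.
Proof.
apply: measurableT_comp => //; apply: measurable_funM => //.
exact: measurableT_comp.
Qed.

Let iW : law.-integrable setT (EFin \o W).
Proof.
apply/integrableP; split; first exact/measurable_EFinP.
move: exp_moment; rewrite unlock; congr (_ < _)%E; apply: eq_integral => w _.
by rewrite /= [`|W w|]ger0_norm ?expR_ge0.
Qed.

Lemma exp_moment_pow k : exists2 c, 0 <= c &
  forall y : R, `|y| ^+ k <= c * expR (alpha * `|y|).
Proof.
(* From u <= exp(u) at u = alpha |y| / (k + 1), raised to the power k; dividing by k + 1 and not by
   k covers k = 0. *)
exists ((k.+1%:R / alpha) ^+ k); first by rewrite exprn_ge0// divr_ge0// ltW.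
move=> y; set u := alpha * `|y| / k.+1%:R.
have u0 : 0 <= u by rewrite divr_ge0// mulr_ge0// ltW.
have -> : `|y| ^+ k = (k.+1%:R / alpha) ^+ k * u ^+ k.
  rewrite -exprMn /u; congr (_ ^+ k); move: (pnatr_eq0 R k.+1) => /=.
  by move: k.+1%:R => q /negbT q0; field; rewrite q0 gt_eqF.
rewrite ler_wpM2l ?exprn_ge0 ?divr_ge0 ?(ltW alpha_gt0)//.
apply: (@le_trans _ _ (expR u ^+ k)).
  by rewrite lerXn2r ?nnegrE ?expR_ge0// (le_trans _ (expR_ge1Dx u))// lerDr.
rewrite -expRM_natl ler_expR /u mulrC mulrAC ler_pdivrMr// ler_wpM2l//.
  by rewrite mulr_ge0// ltW.
by rewrite ler_nat.
Qed.

Lemma exp_moment_integrable k : law.-integrable setT (EFin \o (fun w => f w ^+ k)).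
Proof.
have [c c0 h] := exp_moment_pow k.
apply: (@le_integrable _ _ _ law _ _ _ (EFin \o (fun w => c * W w))) => //.
- by apply/measurable_EFinP; exact: measurable_funX.
- move=> w _ /=; rewrite lee_fin normrX (le_trans (h _))// ler_norm//.
- exact: (integrableZl measurableT _ iW).
Qed.

(** On |f| > L, half of the exponential absorbs the polynomial 1 + |f| + f^2 and the other half
    yields the decay exp(- alpha L / 2). The three estimates concern functions below this polynomial
    times the indicator of |f| > L. *)
Lemma exp_moment_tail : exists2 c, 0 < c &
  forall q : R, 0 <= q -> let L := 2 / alpha * (c + q) in
    [/\ 1 <= L, (law [set w | (L < `|f w|)%R] <= (expR (- q))%:E)%E,
      \int[law]_w `|f w - truncate L id (f w)| <= expR (- q) &
      \int[law]_w (f w ^+ 2 - truncate L id (f w) ^+ 2) <= expR (- q)].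
Proof.
(* Here 1 + y + y^2 <= 2 + 2 y^2, and y = (4 / alpha) u with u <= exp(u) and exp(2 u) = exp(alpha y
   / 2). *)
pose C := 2 + 2 * (4 / alpha) ^+ 2.
pose M1 := \int[law]_w W w.
have C0 : 0 < C by rewrite ltr_pwDl// mulr_ge0// sqr_ge0.
have M10 : 0 <= M1 by apply: Rintegral_ge0 => w _; exact: expR_ge0.
(* The factor [C * M1] is beaten by the exponential of itself; the summand [alpha] ensures
   [1 <= L]. *)
exists (C * M1 + alpha); first by rewrite ltr_wpDl// mulr_ge0// ltW.
move=> q q0 L.
have L1 : 1 <= L.
  rewrite /L (_ : _ * _ = 2 + 2 / alpha * (C * M1 + q)); last first.
    by field; rewrite gt_eqF.
  rewrite ler_wpDr// ?ler1n// mulr_ge0 ?divr_ge0 ?(ltW alpha_gt0)//.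
  by rewrite addr_ge0// mulr_ge0// ltW.
have CM : C * M1 * expR (- (alpha / 2 * L)) <= expR (- q).
  have -> : alpha / 2 * L = (C * M1 + alpha) + q.
    by rewrite /L; field; rewrite gt_eqF.
  rewrite opprD expRD mulrA ler_piMl ?expR_ge0//.
  rewrite expRN ler_pdivrMr ?expR_gt0// mul1r.
  by apply: le_trans (expR_ge1Dx _); have := alpha_gt0; lra.
pose D (y : R) : R := if `|y| <= L then 0 else 1.
have key w : (1 + `|f w| + f w ^+ 2) * D (f w) <= C * expR (- (alpha / 2 * L)) * W w.
  rewrite /D; case: (leP `|f w| L) => [_|Lf].
    by rewrite mulr0 !mulr_ge0 ?expR_ge0// ltW.
  rewrite mulr1; apply: (@le_trans _ _ (C * expR (alpha / 2 * `|f w|))).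
    pose u := alpha / 4 * `|f w|.
    have u0 : 0 <= u by rewrite mulr_ge0// divr_ge0// ltW.
    have eu : 1 + u <= expR u := expR_ge1Dx u.
    have -> : expR (alpha / 2 * `|f w|) = expR u ^+ 2.
      by rewrite -expRM_natl /u; congr expR; field.
    have fu : `|f w| = 4 / alpha * u by rewrite /u; field; rewrite gt_eqF.
    rewrite -[f w ^+ 2]real_normK ?num_real// {2}fu exprMn.
    have e1 : 1 <= expR u ^+ 2 by rewrite exprn_ege1//; lra.
    have e2 : u ^+ 2 <= expR u ^+ 2 by rewrite lerXn2r ?nnegrE ?expR_ge0//; lra.
    have e3 : `|f w| <= 1 + `|f w| ^+ 2.
      have : 0 <= (`|f w| - 1) ^+ 2 by exact: sqr_ge0.
      by have : 0 <= `|f w| ^+ 2 := sqr_ge0 _; lra.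
    rewrite {2}fu exprMn in e3.
    have a0 : 0 <= (4 / alpha) ^+ 2 by exact: sqr_ge0.
    have e4 := ler_wpM2l a0 e2.
    rewrite /C; lra.
  rewrite -[leRHS]mulrA ler_pM2l// /W -expRD ler_expR.
  have : 0 <= alpha / 2 * (`|f w| - L).
    by rewrite mulr_ge0 ?subr_ge0 ?(ltW Lf)// divr_ge0// ltW.
  by lra.
have intW : \int[law]_w (C * expR (- (alpha / 2 * L)) * W w) <= expR (- q).
  by rewrite RintegralZl// mulrAC.
have icW := integrableZl measurableT (C * expR (- (alpha / 2 * L))) iW.
have mtr : measurable_fun setT (fun w => truncate L id (f w)).
  by apply: (measurableT_comp (measurable_truncate L _) mf).
have bound (g : T -> R) : measurable_fun setT g ->
    (forall w, 0 <= g w <= (1 + `|f w| + f w ^+ 2) * D (f w)) ->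
    \int[law]_w g w <= expR (- q).
  move=> mg hg; apply: le_trans intW; apply: le_Rintegral => //.
    apply: (le_integrable measurableT _ _ icW).
      exact/measurable_EFinP.
    move=> w _ /=; have /andP[g0 g1] := hg w.
    rewrite lee_fin ger0_norm// (le_trans g1)// (le_trans (key w))// ler_norm//.
  by move=> w _; have /andP[_ g1] := hg w; apply: le_trans g1 (key w).
have f2 w : 0 <= f w ^+ 2 by exact: sqr_ge0.
split => //.
- have mA : measurable [set w | (L < `|f w|)%R].
    rewrite (_ : [set _ | _] = ~` [set w | (`|f w| <= L)%R]).
      by apply: measurableC; apply: measurable_set_ler => //; exact: measurableT_comp.
    by apply/seteqP; split => w /=; rewrite ltNge => /negP.
  rewrite -[leLHS]fineK ?fin_num_measure// lee_fin.
  have -> : fine (law [set w | (L < `|f w|)%R]) =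
      \int[law]_w (\1_[set w | (L < `|f w|)%R] w).
    by rewrite /Rintegral integral_indic// setIT.
  apply: bound => // w; rewrite indicE /D ler0n /=.
  case: (leP `|f w| L) => Lf; last first.
    by rewrite mulr1 -addrA (@le_trans _ _ 1) ?lerDl ?addr_ge0//; case: (_ \in _).
  by rewrite mulr0 memNset//= ltNge Lf.
- apply: bound => [|w]; first by apply: measurableT_comp => //; exact: measurable_funB.
  rewrite normr_ge0 /truncate /D /=; case: (leP `|f w| L) => _.
    by rewrite subrr normr0 mulr0 lexx.
  by rewrite subr0 mulr1 (addrC 1) -addrA lerDl addr_ge0.
- apply: bound => [|w]; first by apply: measurable_funB; exact: measurable_funX.
  rewrite /truncate /D /=; case: (leP `|f w| L) => _; first by rewrite subrr mulr0 lexx.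
  by rewrite expr0n subr0 mulr1 f2 lerDr addr_ge0.
Qed.

End exponential_moment.

(** * Uniform deviation over the kernel sets *)

Lemma ln2_ge_half {R : realType} : 1 / 2 <= ln (2 : R).
Proof.
rewrite -[leLHS]expRK ler_ln ?posrE ?expR_gt0//.
by apply: le_trans (expR_le_quad _) _; lra.
Qed.

Lemma expR_mul_ln {R : realType} (k n : nat) : (0 < n)%N ->
  expR (- (k%:R * ln n%:R)) = (n%:R : R) ^- k.
Proof. by move=> n0; rewrite expRN expRM_natl lnK// posrE ltr0n. Qed.

Section iid_integral.
Context {R : realType} {dO dT} {Omega : measurableType dO}
  {T : measurableType dT} (P : probability Omega R) (law : probability T R)
  (n : nat) (Z : 'I_n -> {mfun Omega >-> T}).
Hypothesis iidZ : iid_sample P law Z.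

Lemma iid_integral (g : T -> \bar R) i : measurable_fun setT g ->
  (forall z, 0 <= g z)%E -> (\int[P]_w g (Z i w) = \int[law]_z g z)%E.
Proof.
move=> mg g0; rewrite -(@ge0_integral_distribution _ _ _ _ _ P (Z i) g mg g0).
by apply: eq_measure_integral => A mA _; have [_] := iidZ; exact.
Qed.

End iid_integral.

Section uniform_deviation.
Context {R : realType} {d : nat}.
Local Notation T := ('rV[R]_d * measurableTypeR R)%type.
Variable law : probability ('rV[R]_d * measurableTypeR R)%type R.
Variables (l : R -> R) (s : 'rV[R]_d -> R) (m : R).
Variable KK : nat -> set ('rV[R]_d -> 'rV[R]_d -> R).
Hypothesis ml : measurable_fun setT l.
Hypothesis KK_kernel : forall n K, (0 < n)%N -> KK n K -> density_kernel K.
Hypothesis KK_card : forall n, (0 < n)%N -> (KK n #<= `I_n)%card.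
Hypothesis m_gt0 : 0 < m.
Hypothesis cond1 : forall n K, (0 < n)%N -> KK n K ->
  (ereal_sup [set L2norm_sq (K x') | x' in setT] <= (m * n%:R)%:E)%E.
Hypothesis cond2 : forall n K, (0 < n)%N -> KK n K ->
  (L2norm_sq (mean_estimator law l K) <= m%:E)%E.
Hypothesis cond4 : forall n K psi, (0 < n)%N -> KK n K -> psi \in L2fun ->
  ('E_law[(fun w => (L2dot (K w.1) psi) ^+ 2)%R] <= m%:E * L2norm_sq psi)%E.
Hypothesis sL : s \in L2fun.
Hypothesis exp_moment : exists2 alpha : R, 0 < alpha &
  ('E_law[(fun w => expR (alpha * `|l w.2|))%R] < +oo)%E.

Let mf : measurable_fun setT (fun w : T => l w.2).
Proof. exact: (measurableT_comp ml measurable_snd). Qed.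

Let ipow k : law.-integrable setT (EFin \o (fun w => l w.2 ^+ k)).
Proof.
have [alpha a0 ha] := exp_moment.
exact: (exp_moment_integrable mf a0 ha).
Qed.

Let il : law.-integrable setT (fun w => (l w.2)%:E). Proof. exact: (ipow 1). Qed.

Let K_le n K x' : (0 < n)%N -> KK n K -> (L2norm_sq (K x') <= (m * n%:R)%:E)%E.
Proof.
move=> n0 KKn; apply: le_trans (cond1 n0 KKn); apply: ereal_sup_ubound.
by exists x'.
Qed.

(** One exceptional event serves all kernels of the set; the crude bounds hold on it too, so that
    its contribution to the expectation can be estimated afterwards. *)
Lemma bad_event : exists2 c, 0 < c &
  forall n (theta : R), (2 <= n)%N -> 0 < theta < 1 ->
  forall (dO : measure_display) (Omega : measurableType dO)
    (P : probability Omega R) (Z : 'I_n -> {mfun Omega >-> T}),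
  iid_sample P law Z ->
  exists2 bad : set Omega,
    measurable bad /\ (P bad <= (7 / n%:R ^+ 4)%:E)%E &
    forall w K, KK n K -> exists e A : R, [/\
      L2norm_sq (estimator l K (fun i => Z i w) \- s) = e%:E,
      (L2norm_sq (mean_estimator law l K \- s) + mean_L2norm_sq law l K * (n%:R^-1)%:E
        = A%:E)%E,
      0 <= e <= 2 * L2dot s s + 2 * m * \sum_(i < n) l (Z i w).2 ^+ 2,
      0 <= A <= 2 * m + 2 * L2dot s s + m * \int[law]_w (l w.2 ^+ 2) &
      ~ bad w -> `|e - A| <= theta * A + c * (ln n%:R ^+ 4 / (theta * n%:R))].
Proof.
have [alpha a0 ha] := exp_moment.
have [c c0 tail] := exp_moment_tail mf a0 ha.
(* Since 1 <= 2 ln n for n >= 2, the level 2 / alpha * (c + 5 ln n) is at most b ln n. *)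
pose b := 2 / alpha * (2 * c + 5).
have b0 : 0 < b by rewrite mulr_gt0 ?divr_gt0//; lra.
exists (36 * (400 * m * b ^+ 2)) => [|n theta n2 th01 dO Omega P Z iidZ].
  apply: mulr_gt0 => //; apply: mulr_gt0; last exact: exprn_gt0.
  exact: mulr_gt0.
have n0 : (0 < n)%N := ltnW n2.
have nR0 : 0 < n%:R :> R by rewrite ltr0n.
have nR1 : 1 <= n%:R :> R by rewrite ler1n.
have nR2 : 2 <= n%:R :> R by rewrite ler_nat.
have ln_half : 1 / 2 <= ln (n%:R : R).
  by apply: le_trans ln2_ge_half _; rewrite ler_ln ?posrE.
have ln0 : 0 < ln (n%:R : R) by lra.
(* With x = 6 ln n and q = 5 ln n, the unions over n kernels and over n variables both have
   probability of order n^(-4). The factor 6 also gives [3 <= x], as ln n >= 1/2. *)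
have q0 : 0 <= 5 * ln (n%:R : R) by rewrite mulr_ge0// ltW.
pose x := 6 * ln (n%:R : R).
have x3 : 3 <= x by rewrite /x; lra.
have [L1 PL ex1 ex2] := tail _ q0.
set L := 2 / alpha * _ in L1 PL ex1 ex2.
have expx : expR (- x) = n%:R ^- 6 := expR_mul_ln 6 n0.
have expq : expR (- (5 * ln n%:R)) = n%:R ^- 5 := expR_mul_ln 5 n0.
rewrite expq in PL ex1 ex2.
have n51 : (n%:R : R) ^- 5 <= n%:R ^-1.
  by rewrite lef_pV2 ?posrE ?exprn_gt0// exprS ler_peMr ?exprn_ege1// ltW.
have dev K : exists G : set Omega, KK n K ->
    [/\ measurable G, (P (~` G) <= ((n + 9)%:R * expR (- x))%:E)%E &
    forall w (A e : R), G w -> (forall i, `|l (Z i w).2| <= L) ->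
      (L2norm_sq (mean_estimator law l K \- s) + mean_L2norm_sq law l K * (n%:R^-1)%:E
        = A%:E)%E ->
      L2norm_sq (estimator l K (fun i => Z i w) \- s) = e%:E ->
      `|e - A| <= theta * A + 400 * m * (L * x) ^+ 2 / (theta * n%:R)].
  have [KKn|] := pselect (KK n K); last by move=> nK; exists setT => /nK.
  have [G [mG PG] hG] := kernel_deviation n0 m_gt0 (KK_kernel n0 KKn)
    (fun x' => K_le x' n0 KKn) (cond2 n0 KKn) (fun psi => cond4 n0 KKn)
    ml il (ipow 2) sL L1 (le_trans ex1 n51) (le_trans ex2 n51) iidZ x3 th01.
  exists G => _; split=> // w A e Gw lL hA he.
  have AE := etrans (esym hA) (kernel_riskE m_gt0 (KK_kernel n0 KKn)
    (fun x' => K_le x' n0 KKn) (cond2 n0 KKn) ml (ipow 2) sL).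
  rewrite (EFin_inj AE); exact: (hG w e Gw lL he).
have {dev} [G hG] := choice dev.
have /pcard_leP[g] := KK_card n0.
(* The injection [g] numbers the kernels, so that their exceptional events form a sequence; a number
   that is not attained gives the empty event. *)
pose E k := [set w | exists K, [/\ KK n K, g K = k & ~ G K w]].
pose F k := [set w | exists i : 'I_n, i = k :> nat /\ L < `|l (Z i w).2|].
have rareE k : (k < n)%N ->
    measurable (E k) /\ (P (E k) <= ((n + 9)%:R * expR (- x))%:E)%E.
  move=> kn; have [[K [KKn gK]]|nK] := pselect (exists K, KK n K /\ g K = k).
    have -> : E k = ~` G K.
      apply/seteqP; split => w /=; last by move=> GK; exists K.
      move=> [K' [KK' gK' nG]]; suff -> : K = K' by [].
      exact: (@inj _ _ _ g K K' (mem_set KKn) (mem_set KK') (etrans gK (esym gK'))).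
    by have [mG PG _] := hG K KKn; split => //; exact: measurableC.
  have -> : E k = set0.
    by rewrite -subset0 => w [K [KKn gK _]]; apply: nK; exists K.
  by rewrite measure0; split => //; rewrite lee_fin mulr_ge0// expR_ge0.
have mabs : measurable [set z : T | (L < `|l z.2|)%R].
  rewrite (_ : [set _ | _] = ~` [set z : T | (`|l z.2| <= L)%R]).
    by apply: measurableC; apply: measurable_set_ler => //; exact: measurableT_comp.
  by apply/seteqP; split => w /=; rewrite ltNge => /negP.
have rareF k : (k < n)%N -> measurable (F k) /\ (P (F k) <= (n%:R ^- 5)%:E)%E.
  move=> kn; have -> : F k = Z (Ordinal kn) @^-1` [set z : T | (L < `|l z.2|)%R].
    apply/seteqP; split => w /=; last by move=> h; exists (Ordinal kn).
    by move=> [i [ik]]; rewrite (_ : i = Ordinal kn)//; exact: val_inj.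
  split; first by rewrite -[X in measurable X]setTI; exact: measurable_funPT.
  by have [_ h] := iidZ; rewrite [X in (X <= _)%E](h (Ordinal kn) _ mabs).
pose bad := \big[setU/set0]_(k < n) E k `|` \big[setU/set0]_(k < n) F k.
have mE : measurable (\big[setU/set0]_(k < n) E k).
  by apply: bigsetU_measurable => i _; have [] := rareE i (ltn_ord i).
have mF : measurable (\big[setU/set0]_(k < n) F k).
  by apply: bigsetU_measurable => i _; have [] := rareF i (ltn_ord i).
exists bad.
  split; first exact: measurableU.
  apply: le_trans (measureU2 _ mE mF) _.
  apply: le_trans (leeD (union_bound rareE) (union_bound rareF)) _.
  rewrite -EFinD lee_fin expx.
  have -> : n%:R * n%:R ^- 5 = 1 / n%:R ^+ 4 :> R by field; rewrite gt_eqF.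
  have -> : n%:R * ((n + 9)%:R * n%:R ^- 6) = (n%:R + 9) / n%:R / n%:R ^+ 4 :> R.
    by rewrite natrD; field; rewrite gt_eqF.
  rewrite -mulrDl ler_pM2r ?invr_gt0 ?exprn_gt0//.
  rewrite -lerBrDr ler_pdivrMr//; lra.
move=> w K KKn.
have [e eE eb] := estimator_L2 l n0 m_gt0 (KK_kernel n0 KKn)
  (fun x' => K_le x' n0 KKn) sL (fun i => Z i w).
have AE := kernel_riskE m_gt0 (KK_kernel n0 KKn)
    (fun x' => K_le x' n0 KKn) (cond2 n0 KKn) ml (ipow 2) sL.
have Ab := kernel_risk_bounds n0 m_gt0 (KK_kernel n0 KKn)
    (fun x' => K_le x' n0 KKn) (cond2 n0 KKn) ml (ipow 2) sL.
set A := kernel_risk _ _ _ _ _ in AE Ab.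
exists e, A; split=> // nbad.
have [_ _ hGK] := hG K KKn.
have GKw : G K w.
  apply: contrapT => nG; apply: nbad; left; rewrite -bigcup_mkord.
  have gn : (g K < n)%N by have := @funS _ _ _ _ g K KKn.
  by exists (g K) => //; exists K.
have lL i : `|l (Z i w).2| <= L.
  rewrite leNgt; apply/negP => h; apply: nbad; right; rewrite -bigcup_mkord.
  by exists i => //=; exists i.
apply: le_trans (hGK w A e GKw lL AE eE) _; rewrite lerD2l.
have Lb : L <= b * ln n%:R.
  rewrite /L /b -[leRHS]mulrA ler_pM2l ?divr_gt0//.
  have : 0 <= c * (2 * ln (n%:R : R) - 1) by rewrite mulr_ge0 ?(ltW c0)//; lra.
  by lra.
have L0 : 0 <= L by exact: le_trans L1.
have /andP[th0 _] := th01.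
rewrite [leRHS]mulrA ler_pM2r ?invr_gt0 ?mulr_gt0//.
rewrite (_ : 36 * (400 * m * b ^+ 2) * ln n%:R ^+ 4 =
    400 * m * (b * ln n%:R * x) ^+ 2); last first.
  by rewrite /x; ring.
have x0 : 0 <= x by lra.
have bl : 0 <= b * ln (n%:R : R) by rewrite mulr_ge0 ?(ltW b0) ?(ltW ln0).
rewrite ler_pM2l ?mulr_gt0// lerXn2r ?nnegrE ?(mulr_ge0 L0 x0) ?(mulr_ge0 bl x0)//.
exact: ler_wpM2r.
Qed.


(* Off the bad event the deviation is at most [ln n ^ 4 / (theta n)]; on it the
   crude bound [2 |s|^2 + 2 m \sum l_i^2] is used, with [l_i^2 <= n^2 + l_i^4 / n^2]
   so as to avoid controlling the dependence between [l_i] and the event. *)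
Lemma dominating_function : exists2 C, 0 < C &
  forall n (theta : R), (2 <= n)%N -> 0 < theta < 1 ->
  forall (dO : measure_display) (Omega : measurableType dO)
    (P : probability Omega R) (Z : 'I_n -> {mfun Omega >-> T}),
  iid_sample P law Z ->
  exists h : Omega -> R, [/\ measurable_fun setT h, forall w, 0 <= h w,
    (\int[P]_w (h w)%:E <= (C * (ln n%:R ^+ 5 / (theta * n%:R)))%:E)%E &
    forall w K, KK n K -> exists e A : R, [/\
      L2norm_sq (estimator l K (fun i => Z i w) \- s) = e%:E,
      (L2norm_sq (mean_estimator law l K \- s) + mean_L2norm_sq law l K * (n%:R^-1)%:E
        = A%:E)%E,
      e - (1 + theta) * A <= h w &
      A - (1 - theta)^-1 * e <= (1 - theta)^-1 * h w]].
Proof.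
have [c c0 bad_ev] := bad_event.
pose S := L2dot s s.
have S0 : 0 <= S by apply: Rintegral_ge0 => y _; rewrite -expr2 sqr_ge0.
pose C2 := \int[law]_w (l w.2 ^+ 2).
have C20 : 0 <= C2 by apply: Rintegral_ge0 => w _; exact: sqr_ge0.
pose C4 := \int[law]_w (l w.2 ^+ 4).
have l4_ge0 (y : R) : 0 <= y ^+ 4 by rewrite (exprM y 2 2) sqr_ge0.
have C40 : 0 <= C4 by apply: Rintegral_ge0 => w _.
pose C1 := 2 * m + 2 * S + m * C2.
have C10 : 0 <= C1 by rewrite /C1 !addr_ge0 ?mulr_ge0// ltW.
pose D := 7 * C1 + 7 * m + m * C4.
have D0 : 0 <= D by rewrite /D !addr_ge0 ?mulr_ge0// ltW.
(* From 1 <= 2 ln n, the fourth power of the logarithm becomes a fifth at the cost of 2, and a term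
   in 1 / n acquires a fifth power at the cost of 2^5 = 32. *)
exists (2 * c + 32 * D) => [|n theta n2 th01 dO Omega P Z iidZ].
  by rewrite ltr_pwDl ?mulr_gt0// mulr_ge0.
have /andP[th0 th1] := th01.
have n0 : (0 < n)%N := ltnW n2.
have nR0 : 0 < n%:R :> R by rewrite ltr0n.
have nR1 : 1 <= n%:R :> R by rewrite ler1n.
have ln_half : 1 / 2 <= ln (n%:R : R).
  by apply: le_trans ln2_ge_half _; rewrite ler_ln ?posrE// ler_nat.
have ln0 : 0 < ln (n%:R : R) by lra.
have [bad [mbad Pbad] hbad] := bad_ev n theta n2 th01 dO Omega P Z iidZ.
pose r := c * (ln (n%:R : R) ^+ 4 / (theta * n%:R)).
have r0 : 0 <= r.
  by rewrite mulr_ge0 ?divr_ge0 ?exprn_ge0 ?mulr_ge0 ?(ltW c0) ?(ltW ln0) ?(ltW th0).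
(* The deterministic part of the crude bound: [C1] for the norm of s and the risk, m n^3 for n
   weights with n^2 each. Against a probability 7 / n^4 it contributes O(1 / n). *)
pose k := C1 + m * n%:R ^+ 3.
have k0 : 0 <= k by rewrite addr_ge0// mulr_ge0 ?exprn_ge0// ltW.
pose h4 w := \sum_(i < n) l (Z i w).2 ^+ 4.
have h40 w : 0 <= h4 w by apply: sumr_ge0.
have mn0 : 0 <= m / n%:R ^+ 2 by rewrite divr_ge0 ?exprn_ge0// ltW.
pose h w := r + k * \1_bad w + m / n%:R ^+ 2 * h4 w.
have mlZ i : measurable_fun setT (fun w => l (Z i w).2 ^+ 4).
  by apply: measurable_funX; exact: (measurableT_comp mf).
have mh4 : measurable_fun setT h4 by exact: measurable_sum.
have mh1 : measurable_fun setT (fun w => r + k * \1_bad w).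
  by apply: measurable_funD => //; apply: measurable_funM => //; exact: measurable_indic.
have ind0 w : 0 <= \1_bad w :> R by rewrite indicE.
have kb0 w : 0 <= k * \1_bad w by exact: mulr_ge0.
have mh0 w : 0 <= m / n%:R ^+ 2 * h4 w by exact: mulr_ge0.
exists h; split.
- by apply: measurable_funD => //; exact: measurable_funM.
- by move=> w; rewrite /h addr_ge0// addr_ge0.
- have int4 : (\int[P]_w (h4 w)%:E = (n%:R * C4)%:E)%E.
    under eq_integral do rewrite /h4 -sumEFin.
    rewrite ge0_integral_sum//; last 2 first.
    + by move=> i; exact/measurable_EFinP.
    + by move=> i w _; rewrite lee_fin.
    rewrite (eq_bigr (fun=> C4%:E)) => [|i _].
      by rewrite sumEFin sumr_const card_ord mulr_natl.
    rewrite (iid_integral iidZ i (g := fun z => (l z.2 ^+ 4)%:E)).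
    + by rewrite /C4 /Rintegral fineK//; apply: integrable_fin_num => //; exact: (ipow 4).
    + by apply/measurable_EFinP; exact: measurable_funX.
    + by move=> z; rewrite lee_fin.
  under eq_integral do rewrite /h EFinD.
  rewrite ge0_integralD//; last 4 first.
  + by move=> w _; rewrite lee_fin addr_ge0.
  + exact/measurable_EFinP.
  + by move=> w _; rewrite lee_fin.
  + by apply/measurable_EFinP; exact: measurable_funM.
  under eq_integral do rewrite EFinD.
  rewrite ge0_integralD//; last 2 first.
  + by move=> w _; rewrite lee_fin.
  + by apply/measurable_EFinP; apply: measurable_funM => //; exact: measurable_indic.
  have -> : (\int[P]_w (k * \1_bad w)%:E = k%:E * P bad)%E.
    under eq_integral do rewrite EFinM.
    rewrite ge0_integralZl_EFin// ?integral_indic// ?setIT//.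
    by apply/measurable_EFinP; exact: measurable_indic.
  have -> : (\int[P]_w (m / n%:R ^+ 2 * h4 w)%:E =
      (m / n%:R ^+ 2)%:E * (n%:R * C4)%:E)%E.
    under eq_integral do rewrite EFinM.
    rewrite ge0_integralZl_EFin ?int4//; last exact/measurable_EFinP.
    by move=> w _; rewrite lee_fin.
  rewrite integral_cst//= probability_setT mule1.
  apply: (@le_trans _ _ (r%:E + k%:E * (7 / n%:R ^+ 4)%:E +
    (m / n%:R ^+ 2)%:E * (n%:R * C4)%:E)%E).
    by rewrite leeD2r// leeD2l// lee_wpmul2l.
  rewrite -!EFinM -!EFinD lee_fin.
  have e1 : k * (7 / n%:R ^+ 4) + m / n%:R ^+ 2 * (n%:R * C4) <= D / n%:R.
    have -> : m / n%:R ^+ 2 * (n%:R * C4) = m * C4 / n%:R by field; rewrite gt_eqF.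
    have -> : k * (7 / n%:R ^+ 4) = (7 * C1 / n%:R ^+ 3 + 7 * m) / n%:R.
      by rewrite /k; field; rewrite gt_eqF.
    rewrite -mulrDl ler_pM2r ?invr_gt0// /D !lerD2r.
    by rewrite ler_pdivrMr ?exprn_gt0// ler_peMr ?exprn_ege1// mulr_ge0.
  have e2 : 1 <= 32 * ln (n%:R : R) ^+ 5.
    have -> : 32 * ln (n%:R : R) ^+ 5 = (2 * ln n%:R) ^+ 5 by ring.
    by rewrite exprn_ege1//; lra.
  have e3 : D / n%:R <= 32 * D * (ln n%:R ^+ 5 / (theta * n%:R)).
    rewrite invfM [leRHS](_ : _ = D / n%:R * (32 * ln n%:R ^+ 5) / theta); last by ring.
    rewrite ler_pdivlMr//; apply: (@le_trans _ _ (D / n%:R)).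
      by rewrite ler_piMr ?divr_ge0 ?(ltW nR0)// ltW.
    by rewrite ler_peMr// divr_ge0 ?(ltW nR0).
  have e4 : r <= 2 * c * (ln n%:R ^+ 5 / (theta * n%:R)).
    rewrite [leRHS](_ : _ = r * (2 * ln n%:R)); last by rewrite /r; ring.
    by rewrite ler_peMr//; lra.
  rewrite -[leLHS]addrA [leRHS]mulrDl; apply: lerD => //; exact: le_trans e1 e3.
move=> w K KKn; have [e [A [eE AE /andP[e0 e1] /andP[A0 A1] eA]]] := hbad w K KKn.
exists e, A; split => //.
- have [bw|nbw] := pselect (bad w); last first.
    have := eA nbw; rewrite ler_norml => /andP[_ hA].
    have := addr_ge0 (kb0 w) (mh0 w).
    by rewrite -/r in hA; rewrite /h; lra.
  rewrite /h indicE mem_set//= mulr1.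
  have sq2 : 2 * m * (\sum_(i < n) l (Z i w).2 ^+ 2) <=
      m * n%:R ^+ 3 + m / n%:R ^+ 2 * h4 w.
    rewrite -mulrA (mulrCA 2) /h4.
    have -> : m * n%:R ^+ 3 + m / n%:R ^+ 2 * (\sum_(i < n) l (Z i w).2 ^+ 4) =
        m * \sum_(i < n) (n%:R ^+ 2 + l (Z i w).2 ^+ 4 / n%:R ^+ 2).
      rewrite big_split/= sumr_const card_ord -mulr_suml -mulr_natl.
      by field; rewrite gt_eqF.
    rewrite ler_pM2l// mulr_sumr; apply: ler_sum => i _.
    set y := l _ ^+ 2; have -> : l (Z i w).2 ^+ 4 = y ^+ 2 by rewrite /y -exprM.
    rewrite -subr_ge0 (_ : _ - _ = (n%:R - y / n%:R) ^+ 2) ?sqr_ge0//.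
    by field; rewrite gt_eqF.
  have : 0 <= (1 + theta) * A by rewrite mulr_ge0// addr_ge0// ltW.
  rewrite /k /C1; have : 0 <= m * C2 by rewrite mulr_ge0// ltW.
  rewrite -/S in e1; have := m_gt0; lra.
- have thi : 0 < 1 - theta by rewrite subr_gt0.
  rewrite lerBlDl -mulrDr ler_pdivlMl//.
  have [bw|nbw] := pselect (bad w); last first.
    have := eA nbw; rewrite ler_norml => /andP[hA _].
    have := addr_ge0 (kb0 w) (mh0 w).
    by rewrite -/r in hA; rewrite /h; lra.
  (* For the second inequality [e] is dropped by positivity and the deterministic bound on [A]
     suffices. *)
  rewrite /h indicE mem_set//= mulr1.
  have : (1 - theta) * A <= A by rewrite ler_piMl//; lra.
  have : 0 <= m * n%:R ^+ 3 by rewrite mulr_ge0 ?exprn_ge0// ltW.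
  have := mh0 w.
  by rewrite -/S -/C2 -/C1 in A1; rewrite /k; lra.
Qed.

End uniform_deviation.

Unset Implicit Arguments.

Theorem theorem2p8 (R : realType) (d : nat) (d_gt0 : (0 < d)%N)
    (law : probability ('rV[R]_d * measurableTypeR R)%type R)
    (law_ac : law `<< (lebesgue_rV R d \x lebesgue_measure)%E)
    (f : 'rV[R]_d -> R) (f_density : density_fst law f)
    (l : R -> R) (l_borel : measurable_fun setT l)
    (r s : 'rV[R]_d -> R) (r_condexp : cond_expectation law l r)
    (s_def : forall x, s x = r x * f x)
    (KK : nat -> set ('rV[R]_d -> 'rV[R]_d -> R))
    (KK_neq0 : forall n, (0 < n)%N -> KK n !=set0)
    (KK_kernel : forall n K, (0 < n)%N -> KK n K -> density_kernel K)
    (KK_card : forall n, (0 < n)%N -> (KK n #<= `I_n)%card)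
    (m : R) (m_gt0 : 0 < m)
    (cond1 : forall n K, (0 < n)%N -> KK n K ->
      (ereal_sup [set L2norm_sq (K x') | x' in setT] <= (m * n%:R)%:E)%E)
    (cond2 : forall n K, (0 < n)%N -> KK n K ->
      (L2norm_sq (mean_estimator law l K) <= m%:E)%E)
    (cond3 : forall n K K', (0 < n)%N -> KK n K -> KK n K' ->
      (\int[law \x law]_w
         ((L2dot (K w.1.1) (fun x => K' w.2.1 x * l w.2.2)%R) ^+ 2)%:E
       <= m%:E * mean_L2norm_sq law l K')%E)
    (cond4 : forall n K (psi : 'rV[R]_d -> R), (0 < n)%N -> KK n K ->
      psi \in L2fun ->
      ('E_law[(fun w => (L2dot (K w.1) psi) ^+ 2)%R] <= m%:E * L2norm_sq psi)%E)
    (s_L2 : s \in L2fun)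
    (exp_moment : exists2 alpha : R, 0 < alpha &
      ('E_law[(fun w => expR (alpha * `|l w.2|))%R] < +oo)%E) :
  exists c cbar : R, [/\ 0 < c, 0 < cbar &
    forall (n : nat) (theta : R), (2 <= n)%N -> 0 < theta < 1 ->
    forall (dO : measure_display) (Omega : measurableType dO)
      (P : probability Omega R)
      (Z : 'I_n -> {mfun Omega >-> ('rV[R]_d * measurableTypeR R)%type}),
    iid_sample P law Z ->
    (\int[P]_w ereal_sup
       [set L2norm_sq (estimator l K (fun i => Z i w) \- s)
            - (1 + theta)%:E * (L2norm_sq (mean_estimator law l K \- s)
                                + mean_L2norm_sq law l K * (n%:R^-1)%:E)
       | K in KK n]
     <= (c * (ln n%:R ^+ 5 / (theta * n%:R)))%:E)%E /\
    (\int[P]_w ereal_sup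
       [set L2norm_sq (mean_estimator law l K \- s)
            + mean_L2norm_sq law l K * (n%:R^-1)%:E
            - ((1 - theta)^-1)%:E
              * L2norm_sq (estimator l K (fun i => Z i w) \- s)
       | K in KK n]
     <= (cbar * (ln n%:R ^+ 5 / (theta * (1 - theta) * n%:R)))%:E)%E].
Proof.
have [C C0 dom] := dominating_function l_borel KK_kernel KK_card m_gt0 cond1 cond2
  cond4 s_L2 exp_moment.
exists C, C; split=> // n theta n2 th01 dO Omega P Z iidZ.
have /andP[th0 th1] := th01.
have thi : 0 <= (1 - theta)^-1 by rewrite invr_ge0 subr_ge0 ltW.
have [h [mh h0 int_h hK]] := dom n theta n2 th01 dO Omega P Z iidZ.
split.
(* The supremum is compared with [h] pointwise, whether or not it is measurable in the sample. *)
- apply: le_trans int_h; apply: integral_le_ge0 => w; first by rewrite lee_fin.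
  apply: ge_ereal_sup => _ [K KKn <-].
  have [e [A [eE AE eA _]]] := hK w K KKn.
  by rewrite eE AE -EFinM -EFinB lee_fin.
- apply: (@le_trans _ _ (\int[P]_w ((1 - theta)^-1%:E * (h w)%:E))%E).
    apply: integral_le_ge0 => w; first by rewrite -EFinM lee_fin mulr_ge0.
    apply: ge_ereal_sup => _ [K KKn <-].
    have [e [A [eE AE _ eA]]] := hK w K KKn.
    by rewrite eE AE -!EFinM -EFinB lee_fin.
  rewrite ge0_integralZl_EFin//; last 2 first.
  + by move=> w _; rewrite lee_fin.
  + exact/measurable_EFinP.
  apply: le_trans (lee_wpmul2l _ int_h) _; first by rewrite lee_fin.
  rewrite -EFinM lee_fin le_eqVlt; apply/orP; left; apply/eqP; field.
  by rewrite !gt_eqF ?subr_gt0// ltr0n; exact: ltnW.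
Qed.
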